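(* Let $p$ be an odd prime and let $G = \langle a, \mathbf{b}^{(1)}, \ldots, \mathbf{b}^{(p)} \rangle$ be a just infinite group in $\mathscr{C}$. Let $\mathfrak{A}_G$ be its tree enveloping algebra over $F=\mathbb{Z}/p\mathbb{Z}$. Suppose that either $G$ contains a generalised Gupta--Sidki group as a subgroup, or the induced augmentation ideal $\mathrm{Aug}(\mathfrak{A}_G)$ is a graded algebra with the elements $a-1$ and $b^{(j)}_i-1$, for $1\le j\le p$ and $1\le i\le r_j$, being homogeneous. Then $G$ admits a faithful infinite-dimensional irreducible $F$-representation.
   Context: Let $p$ be an odd prime. $T$ is the regular $p$-adic rooted tree: its vertices $u_\omega$ are indexed by the finite words $\omega$ over $X=\{1,\ldots,p\}$, the root being the empty word, with an edge from $u_\omega$ to $u_{\omega x}$ for each $x\in X$. The boundary $\partial T$ is the set of infinite rooted paths. Automorphisms act on the right. $\psi_1\colon \mathrm{Stab}_{\mathrm{Aut}(T)}(1)\to \mathrm{Aut}(T)\times\overset{p}{\ldots}\times\mathrm{Aut}(T)$ is the natural isomorphism from the pointwise stabiliser of the first level, given by restriction to the subtrees rooted at the first-level vertices $u_1,\ldots,u_p$ (each naturally identified with $T$). The class $\mathscr{C}$. Let $a$ be the rooted automorphism that permutes the first-level vertices (with their subtrees) according to the $p$-cycle $(1\;2\;\ldots\;p)$. A datum $\mathbf{E}=(\mathbf{E}^{(1)},\ldots,\mathbf{E}^{(p)})$ consists, for each $j\in\{1,\ldots,p\}$, of an integer $r_j\in\{0,\ldots,p-1\}$, with $r_j\neq 0$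 for at least one $j$, and an $r_j$-tuple $\mathbf{E}^{(j)}=(\mathbf{e}^{(j)}_1,\ldots,\mathbf{e}^{(j)}_{r_j})$ of linearly independent vectors $\mathbf{e}^{(j)}_i=(e^{(j)}_{i,1},\ldots,e^{(j)}_{i,p-1})\in(\mathbb{Z}/p\mathbb{Z})^{p-1}$. The generalised multi-edge spinal group in standard form associated to $\mathbf{E}$ is $G_{\mathbf{E}}=\langle a,\mathbf{b}^{(1)},\ldots,\mathbf{b}^{(p)}\rangle=\langle \{a\}\cup\{b^{(j)}_i\mid 1\le j\le p,\,1\le i\le r_j\}\rangle$, where the family $\mathbf{b}^{(j)}=\{b^{(j)}_1,\ldots,b^{(j)}_{r_j}\}$ consists of the automorphisms $b^{(j)}_i\in\mathrm{Stab}_{\mathrm{Aut}(T)}(1)$ defined recursively by $$\psi_1(b^{(j)}_i)=\big(a^{e^{(j)}_{i,j}},\ldots,a^{e^{(j)}_{i,p-1}},b^{(j)}_i,a^{e^{(j)}_{i,1}},\ldots,a^{e^{(j)}_{i,j-1}}\big),$$ with $b^{(j)}_i$ in coordinate $p-j+1$. The class $\mathscr{C}$ consists of all subgroups of $\mathrm{Aut}(T)$ that are conjugate in $\mathrm{Aut}(T)$ to some $G_{\mathbf{E}}$; for such a conjugate, $a$ and $b^{(j)}_i$ denote the correspondingly conjugated generators. A generalised Gupta--Sidki group is a subgroup $\langle a,b\rangle\le\mathrm{Aut}(T)$, where $a$ is the rooted automorphism above and $b\in \mathrm{Stab}_{\mathrm{Aut}(T)}(1)$ is defined recursively by $\psi_1(b)=(a^{e_1},\ldots,a^{e_{p-1}},b)$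 with $\{e_1,\ldots,e_{p-1}\}=\{1,2,\ldots,p-1\}$. An infinite group is just infinite if all its proper quotients are finite. The tree enveloping algebra $\mathfrak{A}_G$ of $G\le \mathrm{Aut}(T)$ over $F=\mathbb{Z}/p\mathbb{Z}$ is the image of the group algebra $F[G]$ in $\mathrm{End}(F\langle\!\langle\partial T\rangle\!\rangle)$, where $F\langle\!\langle\partial T\rangle\!\rangle$ is the $F$-vector space with basis $\partial T$, and $F[G]$ acts by linear extension of the action of $G$ on $\partial T$. The map is injective on $G$, and elements of $G$ are identified with their images in $\mathfrak{A}_G$. $\mathrm{Aug}(\mathfrak{A}_G)$ is the image in $\mathfrak{A}_G$ of the augmentation ideal of $F[G]$. A graded algebra (without unit) is an algebra with a decomposition $\mathfrak{I}=\bigoplus_{i\ge 1}\mathfrak{I}_i$ such that $\mathfrak{I}_i\mathfrak{I}_j\subseteq\mathfrak{I}_{i+j}$. *)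

(* Defs.v *)
From HB Require Import structures.
From mathcomp Require Import all_boot all_algebra.
From mathcomp Require Import boolp classical_sets functions cardinality.
From mathcomp Require Import freeg zify.

Set Implicit Arguments.
Unset Strict Implicit.
Unset Printing Implicit Defensive.

Import GRing.Theory.
Local Open Scope classical_set_scope.
Local Open Scope ring_scope.

(* Letters and first-level coordinates 1, ..., p of the literature are        *)
(* numbered 0, ..., p.-1 here, i.e. the alphabet X is 'I_p.                   *)

Section RootedTree.
Variable p : nat.

Definition tree_edge (u v : seq 'I_p) : bool := [exists x, v == rcons u x].

Definition is_tree_aut (f : seq 'I_p -> seq 'I_p) : Prop :=
  [/\ bijective f, f [::] = [::]
    & forall u v, tree_edge (f u) (f v) = tree_edge u v].

Record tree_aut := TreeAut {
  tree_aut_fun :> seq 'I_p -> seq 'I_p;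
  _ : `[< is_tree_aut tree_aut_fun >] }.

HB.instance Definition _ := [isSub for tree_aut_fun].
HB.instance Definition _ := [Choice of tree_aut by <:].

Lemma tree_autP (g : tree_aut) : is_tree_aut g.
Proof. by case: g => f /= /asboolP. Qed.

Lemma tree_aut_eq (g h : tree_aut) : g =1 h -> g = h.
Proof. by move=> gh; apply: val_inj; apply: funext. Qed.

Lemma tree_edgeP u v : reflect (exists x, v = rcons u x) (tree_edge u v).
Proof. exact: 'exists_eqP. Qed.

Lemma tree_aut_rcons (g : tree_aut) u x : exists y, g (rcons u x) = rcons (g u) y.
Proof.
have [_ _ e] := tree_autP g; apply/tree_edgeP; rewrite e.
by apply/tree_edgeP; exists x.
Qed.

Lemma tree_aut_nil (g : tree_aut) : g [::] = [::].
Proof. by have [] := tree_autP g. Qed.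

Lemma is_tree_autI f f' : cancel f f' -> cancel f' f -> f [::] = [::] ->
  (forall u x, exists y, f (rcons u x) = rcons (f u) y) -> is_tree_aut f.
Proof.
move=> fK f'K f0 fr; split; [by exists f' | by [] | move=> u v].
apply/tree_edgeP/tree_edgeP => [[x]|[x ->]]; last exact: fr.
case/lastP: v => [|v y]; first by rewrite f0; case: (f u).
have [z ->] := fr v y => /rcons_inj[fuv _]; exists y.
by rewrite -(fK u) -fuv fK.
Qed.

Definition mk_tree_aut f f' (fK : cancel f f') (f'K : cancel f' f)
  (f0 : f [::] = [::]) (fr : forall u x, exists y, f (rcons u x) = rcons (f u) y) :=
  TreeAut (asboolT (is_tree_autI fK f'K f0 fr)).

Definition tree_id : tree_aut.
Proof.
by apply: (@mk_tree_aut id id) => // u x; exists x.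
Defined.

Lemma tree_comp_subproof (g h : tree_aut) : `[< is_tree_aut (h \o g) >].
Proof.
apply/asboolP; have [bg g0 eg] := tree_autP g; have [bh h0 eh] := tree_autP h.
split; [exact: bij_comp | by rewrite /= g0 | by move=> u v /=; rewrite eh eg].
Qed.

(* Automorphisms act on the right: [tree_comp g h] is [g] followed by [h].    *)
Definition tree_comp (g h : tree_aut) : tree_aut := TreeAut (tree_comp_subproof g h).

Lemma tree_inv_subproof (g : tree_aut) :
  exists h : tree_aut, cancel g h /\ cancel h g.
Proof.
have [[f gK fK] g0 eg] := tree_autP g.
suff H : `[< is_tree_aut f >] by exists (TreeAut H).
apply/asboolP; split; [by exists g | by rewrite -{1}g0 gK | move=> u v].
by rewrite -eg !fK.
Qed.

Definition tree_inv (g : tree_aut) : tree_aut := sval (cid (tree_inv_subproof g)).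

Lemma tree_compA : associative tree_comp. Proof. by move=> f g h; exact: val_inj. Qed.
Lemma tree_comp1 : left_id tree_id tree_comp. Proof. by move=> f; exact: val_inj. Qed.
Lemma tree_compr1 : right_id tree_id tree_comp. Proof. by move=> f; exact: val_inj. Qed.
Lemma tree_compV : left_inverse tree_id tree_inv tree_comp.
Proof.
move=> g; apply: tree_aut_eq => u /=; rewrite /tree_inv.
by case: cid => h [].
Qed.
Lemma tree_comprV : right_inverse tree_id tree_inv tree_comp.
Proof.
move=> g; apply: tree_aut_eq => u /=; rewrite /tree_inv.
by case: cid => h [].
Qed.

HB.instance Definition _ := isGroup.Build tree_aut
  tree_compA tree_comp1 tree_compr1 tree_compV tree_comprV.

Definition stab1 (g : tree_aut) : Prop := forall x, g [:: x] = [:: x].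

Lemma tree_aut_cons (g : tree_aut) x w : exists y w', g (x :: w) = y :: w'.
Proof.
have [[f gK _] g0 _] := tree_autP g.
case E: (g (x :: w)) => [|y w']; last by exists y, w'.
by have := gK (x :: w); rewrite E -{1}g0 gK.
Qed.

Lemma tree_aut_head (g : tree_aut) x w :
  g (x :: w) = g [:: x] ++ behead (g (x :: w)).
Proof.
have s1 : size (g [:: x]) = 1%N.
  by have [y] := tree_aut_rcons g [::] x; rewrite tree_aut_nil /= => ->.
case gx: (g [:: x]) s1 => [|z [|//]] // _.
elim/last_ind: w => [|w y IH]; first by rewrite gx.
rewrite -rcons_cons; have [t ->] := tree_aut_rcons g (x :: w) y.
by rewrite IH.
Qed.

Lemma section_subproof (g : tree_aut) x :
  `[< is_tree_aut (fun w => behead (g (x :: w))) >].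
Proof.
apply/asboolP; have [[f gK fK] g0 _] := tree_autP g.
have [y gx] : exists y, g [:: x] = [:: y].
  by have [y] := tree_aut_rcons g [::] x; rewrite g0; exists y.
have gw w : g (x :: w) = y :: behead (g (x :: w)) by rewrite tree_aut_head gx.
pose f' w := behead (f (y :: w)).
have fw w : exists w', y :: w = g (x :: w').
  have [h [gh hg]] := tree_inv_subproof g.
  exists (behead (h (y :: w))).
  have : h (y :: w) = x :: behead (h (y :: w)) by rewrite tree_aut_head -gx gh.
  by move=> <-; rewrite hg.
apply: (@is_tree_autI _ f').
- by move=> w; rewrite /f' -gw gK.
- by move=> w; have [w' e] := fw w; rewrite /f' e gK -e.
- by rewrite gx.
- move=> u z; have [t] := tree_aut_rcons g (x :: u) z.
  by rewrite rcons_cons (gw u) => -> /=; exists t.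
Qed.

Definition psi1 (g : tree_aut) (x : 'I_p) : tree_aut := TreeAut (section_subproof g x).

Definition rooted_fun (w : seq 'I_p) : seq 'I_p :=
  if w is x :: w' then ordS x :: w' else [::].

Lemma rooted_subproof : `[< is_tree_aut rooted_fun >].
Proof.
apply/asboolP; pose f' (w : seq 'I_p) := if w is x :: w' then ord_pred x :: w' else [::].
apply: (@is_tree_autI _ f') => //.
- by case=> //= x w; rewrite ordSK.
- by case=> //= x w; rewrite ord_predK.
- by case=> [|y u] x /=; [exists (ordS x) | exists x].
Qed.

Definition rooted : tree_aut := TreeAut rooted_subproof.

Section Spinal.
Variables (j : nat) (e : 'rV['F_p]_p.-1).

(* The index, in the vector e, of the exponent of a in coordinate x of        *)
(* psi1 b; it is None exactly for the coordinate in which b itself occurs.    *)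
Definition spinal_index (x : 'I_p) : option 'I_p.-1 := insub ((j + x) %% p)%N.

Fixpoint spinal_fun (w : seq 'I_p) : seq 'I_p :=
  if w is x :: w' then
    x :: (if spinal_index x is Some t
          then (rooted ^+ (e ord0 t : nat))%g w' else spinal_fun w')
  else [::].

Lemma spinal_subproof : `[< is_tree_aut spinal_fun >].
Proof.
pose f' := fix f' (w : seq 'I_p) : seq 'I_p := if w is x :: w' then
    x :: (if spinal_index x is Some t
          then ((rooted ^+ (e ord0 t : nat))^-1)%g w' else f' w')
  else [::].
have K (g : tree_aut) : cancel g (g^-1)%g /\ cancel (g^-1)%g g.
  by split=> w; [have := mulgV g | have := mulVg g]; move/(congr1 (fun k : tree_aut => k w)).
apply/asboolP; apply: (@is_tree_autI _ f') => //.
- elim=> //= x w IH; case: spinal_index => [t|]; last by rewrite IH.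
  by rewrite (K _).1.
- elim=> //= x w IH; case: spinal_index => [t|]; last by rewrite IH.
  by rewrite (K _).2.
- elim=> [|y u IH] x /=.
    by case: spinal_index => [t|]; rewrite ?tree_aut_nil; exists x.
  case: spinal_index => [t|].
    by have [z ->] := tree_aut_rcons (rooted ^+ (e ord0 t : nat))%g u x; exists z.
  by have [z ->] := IH x; exists z.
Qed.

(* With (e_1, ..., e_{p-1}) the entries of e, this is the automorphism b in   *)
(* Stab(1) such that psi1 b is                                                *)
(*   (a^e_{j+1}, ..., a^e_{p-1}, b, a^e_1, ..., a^e_j),                       *)
(* hence a generator of the family numbered j+1; see [psi1_spinal].           *)
Definition spinal : tree_aut := TreeAut spinal_subproof.

Lemma spinal_stab1 : stab1 spinal.
Proof.
by move=> x /=; case: spinal_index => // t; rewrite tree_aut_nil.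
Qed.

Lemma psi1_spinal x :
  psi1 spinal x =
    if spinal_index x is Some t then (rooted ^+ (e ord0 t : nat))%g else spinal.
Proof. by apply: tree_aut_eq => w /=; case: spinal_index. Qed.

Lemma spinal_unique b : stab1 b ->
  (forall x, psi1 b x =
    if spinal_index x is Some t then (rooted ^+ (e ord0 t : nat))%g else b) ->
  b = spinal.
Proof.
move=> b1 bE; apply: tree_aut_eq; elim=> [|x w IH]; first by rewrite tree_aut_nil.
have -> : b (x :: w) = x :: psi1 b x w by rewrite tree_aut_head b1.
by rewrite bE /=; case: spinal_index => // ; rewrite IH.
Qed.

End Spinal.
End RootedTree.

Lemma spinal_indexE p (j x : 'I_p) :
  omap val (spinal_index j x) =
  (if j + x < p.-1 then Some (j + x)
   else if j + x == p.-1 then None else Some (j + x - p))%N.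
Proof.
have p0 : (0 < p)%N by case: p j {x} => [[]|].
have [jp xp] := (ltn_ord j, ltn_ord x).
rewrite /spinal_index; case: ltnP => [h|].
  by rewrite modn_small ?insubT //; lia.
rewrite leq_eqVlt eq_sym; case: eqP => [-> _|_ /= h].
  by rewrite modn_small ?insubF //; lia.
have -> : ((j + x) %% p = j + x - p)%N.
  have h' : (p <= j + x)%N by lia.
  by rewrite -{1}(subnK h') modnDr modn_small //; lia.
by rewrite insubT //; lia.
Qed.

Section Subgroups.
Variable gT : groupType.
Implicit Types (A G H N : set gT).

Definition is_subgroup H : Prop := group_closed [in H].

Definition generated A : set gT := smallest is_subgroup A.

Definition conj_set H (h : gT) : set gT := [set (g ^ h)%g | g in H].

Definition normal_in N G : Prop :=
  [/\ is_subgroup N, N `<=` G & forall x g, N x -> G g -> N (x ^ g)%g].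

Definition quotient_set G N : set (set gT) := [set [set (g * x)%g | x in N] | g in G].

Definition just_infinite G : Prop :=
  infinite_set G /\
  forall N, normal_in N G -> N <> [set 1%g] -> finite_set (quotient_set G N).

End Subgroups.

Section SpinalGroups.
Variable p : nat.

Record spinal_datum := SpinalDatum {
  sd_rank : 'I_p -> 'I_p;
  sd_vec : forall j, 'M['F_p]_(sd_rank j, p.-1);
  sd_rank_neq0 : exists j, (sd_rank j != 0 :> nat);
  sd_free : forall j, row_free (sd_vec j) }.

Definition sd_gen (E : spinal_datum) (j : 'I_p) (i : 'I_(sd_rank E j)) : tree_aut p :=
  spinal j (row i (sd_vec E j)).

Definition spinal_group (E : spinal_datum) : set (tree_aut p) :=
  generated (rooted p |` [set g | exists j i, g = @sd_gen E j i]).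

Definition gen_gupta_sidki (H : set (tree_aut p)) : Prop :=
  exists e : 'rV['F_p]_p.-1,
    [set e ord0 t | t in [set: 'I_p.-1]] = [set x | x != 0] /\
    H = generated [set rooted p; spinal 0 e].

End SpinalGroups.

Section FreeModule.
Variables (R : nzRingType) (K : choiceType) (M : lmodType R) (f : K -> M).

HB.instance Definition _ :=
  GRing.isAdditive.Build {freeg K / R} M (fglift f) (lift_is_additive f).

Lemma fglift_scalable : scalable (fglift f : {freeg K / R} -> M).
Proof.
move=> c D; rewrite -{2}(freeg_sumE D) {1}/GRing.scale /= /fgscale.
rewrite !raddf_sum; apply: eq_bigr => x _.
by rewrite /= !liftU scalerA.
Qed.

HB.instance Definition _ :=
  GRing.isScalable.Build R {freeg K / R} M *:%R (fglift f) fglift_scalable.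

End FreeModule.

Section TreeEnvelopingAlgebra.
Variable p : nat.

Definition is_ray (r : nat -> seq 'I_p) : Prop :=
  r 0%N = [::] /\ forall n, tree_edge (r n) (r n.+1).

Record boundary := Boundary { ray :> nat -> seq 'I_p; _ : `[< is_ray ray >] }.

HB.instance Definition _ := [isSub for ray].
HB.instance Definition _ := [Choice of boundary by <:].

Lemma boundary_act_subproof (g : tree_aut p) (xi : boundary) :
  `[< is_ray (fun n => g (xi n)) >].
Proof.
apply/asboolP; case: xi => r /= /asboolP[r0 re]; have [_ g0 ge] := tree_autP g.
by split=> [|n]; rewrite ?r0 // ge.
Qed.

Definition boundary_act (g : tree_aut p) (xi : boundary) : boundary :=
  Boundary (boundary_act_subproof g xi).

Definition boundary_space : lmodType 'F_p := {freeg boundary / 'F_p}.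

Definition tree_op (g : tree_aut p) : boundary_space -> boundary_space :=
  fglift (fun xi => Freeg [:: (1, boundary_act g xi)]).

(* The group algebra F[Aut T] is represented by its underlying space          *)
(* {freeg (tree_aut p) / 'F_p}; on its image in the endomorphisms the product *)
(* is composition, see [tree_opM].                                            *)
Definition env_map (x : {freeg (tree_aut p) / 'F_p}) : boundary_space -> boundary_space :=
  fglift tree_op x.

Lemma tree_opU g (xi : boundary) :
  tree_op g (Freeg [:: (1, xi)]) = Freeg [:: (1, boundary_act g xi)].
Proof. by rewrite /tree_op liftU scale1r. Qed.

Lemma tree_opM g h : tree_op (g * h)%g = tree_op h \o tree_op g.
Proof.
apply: funext => v /=; rewrite -(freeg_sumE v) /tree_op.
rewrite !raddf_sum; apply: eq_bigr => xi _ /=.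
by rewrite !liftU linearZ /= liftU scale1r; congr (_ *: Freeg [:: (1, _)]); exact: val_inj.
Qed.

Lemma env_mapU g : env_map (Freeg [:: (1, g)]) = tree_op g.
Proof. by rewrite /env_map liftU scale1r. Qed.

Lemma env_map_linear x : linear (env_map x).
Proof.
move=> c u v; rewrite -(freeg_sumE x) /env_map raddf_sum !fct_sumE scaler_sumr.
rewrite -big_split; apply: eq_bigr => g _ /=.
rewrite liftU -[LHS]/(coeff g x *: tree_op g (c *: u + v)).
by rewrite /tree_op linearP scalerDr scalerA mulrC -scalerA.
Qed.

Definition augmentation (x : {freeg (tree_aut p) / 'F_p}) : 'F_p :=
  fglift (fun _ => 1 : ('F_p)^o) x.

Definition group_algebra (G : set (tree_aut p)) : set {freeg (tree_aut p) / 'F_p} :=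
  [set x | [set` dom x] `<=` G].

Definition env_algebra (G : set (tree_aut p)) : set (boundary_space -> boundary_space) :=
  env_map @` group_algebra G.

Definition env_aug (G : set (tree_aut p)) : set (boundary_space -> boundary_space) :=
  env_map @` (group_algebra G `&` [set x | augmentation x = 0]).

Definition tree_op_sub1 (g : tree_aut p) : boundary_space -> boundary_space :=
  tree_op g - tree_op 1%g.

End TreeEnvelopingAlgebra.

Section Grading.
Variables (R : nzRingType) (V : lmodType R).

(* I 0 is ignored. Endomorphisms act on the right: the product x y is y \o x. *)
Definition is_grading (A : set (V -> V)) (I : nat -> set (V -> V)) : Prop :=
  [/\ forall i, (0 < i)%N -> submod_closed [in I i] /\ I i `<=` A,
      forall x, A x -> exists n (c : nat -> V -> V),
        (forall i, (0 < i < n)%N -> I i (c i)) /\ x = \sum_(1 <= i < n) c i,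
      forall n (c : nat -> V -> V), (forall i, (0 < i < n)%N -> I i (c i)) ->
        \sum_(1 <= i < n) c i = 0 -> forall i, (0 < i < n)%N -> c i = 0
    & forall i j x y, (0 < i)%N -> (0 < j)%N -> I i x -> I j y -> I (i + j)%N (y \o x)].

Definition homogeneous (I : nat -> set (V -> V)) (x : V -> V) : Prop :=
  exists2 i, (0 < i)%N & I i x.

End Grading.

Section Representations.
Variables (gT : groupType) (F : fieldType) (V : lmodType F).
Implicit Types (G : set gT) (rho : gT -> {linear V -> V}).

(* The values of rho outside G are irrelevant. *)
Definition is_repr G rho : Prop :=
  (forall v, rho 1%g v = v) /\
  (forall g h v, G g -> G h -> rho (g * h)%g v = rho g (rho h v)).

Definition repr_faithful G rho : Prop :=
  forall g h, G g -> G h -> rho g =1 rho h -> g = h.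

Definition repr_irreducible G rho : Prop :=
  (exists v : V, v != 0) /\
  forall W : set V, submod_closed [in W] ->
    (forall g v, G g -> W v -> W (rho g v)) -> W = [set 0] \/ W = setT.

Definition finite_dimensional : Prop :=
  exists n (e : 'I_n -> V), forall v, exists c : 'I_n -> F, v = \sum_i c i *: e i.

End Representations.

Arguments finite_dimensional F V : clear implicits.

(* Main.v *)
(* Write K, J for the sums of the powers of a spinal generator b and of a, and r for   *)
(* the number of nonzero entries of its vector. On the functions on the vertices, taken *)
(* modulo those that vanish eventually along each ray, KJ has an explicit self-similar *)
(* eigenvector Y with eigenvalue r, which is invertible mod p. Hence some irreducible  *)
(* subquotient V contains a nonzero vector fixed by KJ/r. If V is infinite-dimensional *)
(* it is faithful, since a nontrivial kernel would have finite index in G.             *)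
(*                                                                                     *)
(* Suppose that V is finite-dimensional. If G contains a generalised Gupta-Sidki group *)
(* then this group is a torsion p-group, so it acts on V through a finite p-group and  *)
(* KJ is nilpotent on V. If Aug is graded then sending each homogeneous component x of *)
(* degree i to x t^i gives a homomorphism from G to matrices over F[t]. Its image is   *)
(* infinite because KJ is not nilpotent on V, so it is injective as G is just          *)
(* infinite. But G is weakly branch: it contains arbitrarily many pairs (x_i, y_i) for *)
(* which x_i and y_k commute if and only if i <> k, so that the x_i are linearly       *)
(* independent matrices.                                                               *)

From HB Require Import structures.
Require Import Defs.
From mathcomp Require Import all_boot all_algebra.
From mathcomp Require Import boolp classical_sets functions cardinality.
From mathcomp Require Import freeg zify.
From mathcomp Require fingroup cyclic pgroup mxrepresentation mxabelem.

Set Implicit Arguments.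
Unset Strict Implicit.
Unset Printing Implicit Defensive.

Import GRing.Theory.
Local Open Scope classical_set_scope.
Local Open Scope ring_scope.

(** * Submodules and subquotients *)

(** Let K and J be the sums of the p powers of a spinal generator b and of a. Where a and b act
    trivially, KJ acts as p^2 = 0. The point is to find a representation in which KJ has a nonzero
    eigenvector with nonzero eigenvalue. It lives on the functions on the vertices of the tree,
    modulo those that vanish eventually along each ray: [eigenvector] defines it by a self-similar
    recursion. Its eigenvalue is the number r of nonzero entries of the vector of b, and 0 < r < p.

    By Zorn's lemma ([simple_subquotient]) some irreducible subquotient V of this representation of
    G keeps the eigenvector nonzero. If V is infinite-dimensional it is faithful, because a
    nontrivial kernel would have finite index and orbits would be finite
    ([infinite_irreducible_faithful]). It remains to exclude that V is finite-dimensional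
    ([irreducible_of_eigenvector]).

    Suppose that G contains a generalised Gupta-Sidki group H, and take a and b in H. The entries of
    the vector of b add up to 0, which makes every element of H of p-power order
    ([spinal_rank2_torsion]). On a finite-dimensional space over the field with p elements, H then
    acts through a finite p-group, hence trivially on each irreducible subquotient, and KJ is 0
    there ([ptorsion_norm_product]).

    Suppose that the augmentation ideal is graded. The action on vertex functions factors through
    the enveloping algebra ([word_combination_env]), so a finite-dimensional V gives matrices for
    its elements. Weighting the component of degree i by the i-th power of a variable t turns this
    into a homomorphism from G to matrices over F[t]. Its image is infinite, since bounded degrees
    would make KJ nilpotent on V; so it is injective, as G is just infinite. But weak branching
    ([weakly_regular_branch]) provides arbitrarily many pairs x_i, y_i in G such that x_i and y_k
    commute exactly when i and k differ ([commuting_pairs]), and matrices of a fixed size allow only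
    boundedly many ([commuting_pairs_bound]). This is [graded_contradiction]. *)

Section Submodules.
Variables (F : fieldType) (U : lmodType F).
Implicit Types W : set U.

Lemma submodP W : submod_closed [in W] <->
  W 0 /\ forall c u v, W u -> W v -> W (c *: u + v).
Proof.
split=> -[W0 WL]; split.
- by move: W0; rewrite inE.
- by move=> c u v Wu Wv; move: (WL c u v); rewrite !inE; apply.
- by rewrite inE.
- by move=> c u v; rewrite !inE; exact: WL.
Qed.

Lemma submod_add W u v : submod_closed [in W] -> W u -> W v -> W (u + v).
Proof. by move=> /submodP[_ WL] Wu Wv; rewrite -[u]scale1r; exact: WL. Qed.

Lemma submod_scale W c u : submod_closed [in W] -> W u -> W (c *: u).
Proof. by move=> /submodP[W0 WL] Wu; rewrite -[c *: u]addr0; exact: WL. Qed.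

Lemma submod_sub W u v : submod_closed [in W] -> W u -> W v -> W (u - v).
Proof.
by move=> WS Wu Wv; apply: submod_add => //; rewrite -scaleN1r; exact: submod_scale.
Qed.

Lemma submod_sum W I (s : seq I) (P : pred I) (f : I -> U) : submod_closed [in W] ->
  (forall i, P i -> W (f i)) -> W (\sum_(i <- s | P i) f i).
Proof.
move=> WS Wf; apply: big_ind => //; first by have /submodP[] := WS.
by move=> x y; exact: submod_add.
Qed.

End Submodules.

Section LinearMap.
Variables (F : fieldType) (U V : lmodType F) (f : U -> V) (f_linear : linear f).

Definition linear_map_of of linear f := f.

HB.instance Definition _ :=
  GRing.isLinear.Build F U V *:%R (linear_map_of f_linear) f_linear.

Definition linear_map : {linear U -> V} := linear_map_of f_linear.

End LinearMap.

Section Subquotient.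
Variables (F : fieldType) (U : lmodType F) (C M : set U).
Hypotheses (subC : submod_closed [in C]) (subM : submod_closed [in M]).
Hypothesis (MC : M `<=` C).

(** A chosen element of the coset of u modulo M. The quotient of C by M is realised as the set of
    chosen representatives that lie in C. *)
Let repr u : U := xget 0 [set v | M (v - u)].

Let M0 : M 0. Proof. by have /submodP[] := subM. Qed.
Let C0 : C 0. Proof. by have /submodP[] := subC. Qed.

Let repr_sub u : M (repr u - u).
Proof. by rewrite /repr; apply: (@xgetPex _ 0 [set v | M (v - u)]); exists u; rewrite /= subrr. Qed.

Let eq_repr u v : M (u - v) -> repr u = repr v.
Proof.
move=> Muv; rewrite /repr; congr xget; apply/seteqP; split=> w /= Mw.
  by rewrite -(subrKA u w (- v)); exact: submod_add.
rewrite -(subrKA v w (- u)); apply: submod_add => //.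
by rewrite -opprB -scaleN1r; exact: submod_scale.
Qed.

Let reprK u : repr (repr u) = repr u.
Proof. by apply: eq_repr; exact: repr_sub. Qed.

Let repr_in u : C u -> C (repr u).
Proof. by move=> Cu; rewrite -(subrK u (repr u)); apply: submod_add => //; apply: MC. Qed.

Let sqP u := (u \in C) && (repr u == u).

Definition subquotient_of of submod_closed [in C] & submod_closed [in M] & M `<=` C :=
  {u : U | sqP u}.
Definition subquotient := subquotient_of subC subM MC.
HB.instance Definition _ := SubChoice.copy subquotient {u : U | sqP u}.

Let sq_subproof u : C u -> sqP (repr u).
Proof. by move=> Cu; rewrite /sqP reprK eqxx andbT inE; exact: repr_in. Qed.

(** Total for convenience: outside C the value is the class of 0, and all statements below are
    restricted to C. *)
Definition subquotient_pi u : subquotient :=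
  if pselect (C u) is left Cu then Sub (repr u) (sq_subproof Cu)
  else Sub (repr 0) (sq_subproof C0).
Local Notation pi := subquotient_pi.

Let val_pi u : C u -> val (pi u) = repr u.
Proof. by rewrite /pi; case: pselect. Qed.

Let valC (x : subquotient) : C (val x).
Proof. by have /andP[] := valP x; rewrite inE. Qed.

Lemma subquotient_piP u v : C u -> C v -> pi u = pi v <-> M (u - v).
Proof.
move=> Cu Cv; split=> [/(congr1 val)|Muv]; last first.
  by apply: val_inj; rewrite !val_pi //; exact: eq_repr.
rewrite !val_pi // => e.
have -> : u - v = (repr v - v) - (repr u - u) by rewrite e opprB [RHS]addrC addrA subrK.
exact: submod_sub.
Qed.

Let pi_val x : pi (val x) = x.
Proof. by apply: val_inj; rewrite val_pi; [have /andP[_ /eqP] := valP x | exact: valC]. Qed.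

Lemma subquotient_pi_surj (x : subquotient) : exists2 u, C u & pi u = x.
Proof. by exists (val x). Qed.

Let add (x y : subquotient) := pi (val x + val y).
Let opp (x : subquotient) := pi (- val x).
Let scale c (x : subquotient) := pi (c *: val x).

Let addC u v : C u -> C v -> C (u + v). Proof. exact: submod_add. Qed.
Let scaleC c u : C u -> C (c *: u). Proof. exact: submod_scale. Qed.
Let oppC u : C u -> C (- u). Proof. by rewrite -scaleN1r; exact: scaleC. Qed.

Let sub_val_pi u : C u -> M (u - val (pi u)).
Proof. by move=> Cu; rewrite val_pi // -opprB -scaleN1r; exact: submod_scale. Qed.

Let pi_add u v : C u -> C v -> pi (u + v) = add (pi u) (pi v).
Proof.
move=> Cu Cv; apply/subquotient_piP; [exact: addC | by apply: addC; exact: valC | ].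
by rewrite opprD addrACA; apply: submod_add => //; exact: sub_val_pi.
Qed.

Let pi_scale c u : C u -> pi (c *: u) = scale c (pi u).
Proof.
move=> Cu; apply/subquotient_piP; [exact: scaleC | by apply: scaleC; exact: valC | ].
by rewrite -scalerBr; apply: submod_scale => //; exact: sub_val_pi.
Qed.

Let pi_opp u : C u -> pi (- u) = opp (pi u).
Proof. by move=> Cu; rewrite -scaleN1r pi_scale // /scale scaleN1r. Qed.

Let ind (P : subquotient -> Prop) : (forall u, C u -> P (pi u)) -> forall x, P x.
Proof. by move=> H x; have [u Cu <-] := subquotient_pi_surj x; exact: H. Qed.

Let addA : associative add.
Proof.
apply: ind => u Cu; apply: ind => v Cv; apply: ind => w Cw.
by rewrite -!pi_add ?addrA //; exact: addC.
Qed.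
Let addCo : commutative add.
Proof. by apply: ind => u Cu; apply: ind => v Cv; rewrite -!pi_add // addrC. Qed.
Let add0 : left_id (pi 0) add.
Proof. by apply: ind => u Cu; rewrite -pi_add // add0r. Qed.
Let addN : left_inverse (pi 0) opp add.
Proof. by apply: ind => u Cu; rewrite -pi_opp // -pi_add ?addNr //; exact: oppC. Qed.

HB.instance Definition _ := GRing.isZmodule.Build subquotient addA addCo add0 addN.

Let scaleA a b x : scale a (scale b x) = scale (a * b) x.
Proof. by elim/ind: x => u Cu; rewrite -!pi_scale ?scalerA //; exact: scaleC. Qed.
Let scale1 : left_id 1 scale.
Proof. by apply: ind => u Cu; rewrite -pi_scale // scale1r. Qed.
Let scaleDr : right_distributive scale +%R.
Proof.
move=> a; apply: ind => u Cu; apply: ind => v Cv.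
rewrite -[pi u + pi v](pi_add Cu Cv) -!pi_scale //; last exact: addC.
by rewrite scalerDr pi_add //; exact: scaleC.
Qed.
Let scaleDl x a b : scale (a + b) x = scale a x + scale b x.
Proof.
elim/ind: x => u Cu; rewrite -!pi_scale // scalerDl pi_add //; exact: scaleC.
Qed.

HB.instance Definition _ := GRing.Zmodule_isLmodule.Build F subquotient
  scaleA scale1 scaleDr scaleDl.

Lemma subquotient_pi_linear c u v : C u -> C v -> pi (c *: u + v) = c *: pi u + pi v.
Proof. by move=> Cu Cv; rewrite pi_add ?pi_scale //; exact: scaleC. Qed.

End Subquotient.

Section SimpleSubquotient.
Variables (F : fieldType) (U : lmodType F) (gT : groupType) (G : set gT).
Variables (r : gT -> {linear U -> U}) (D : set U) (u0 : U).
Hypotheses (subG : is_subgroup G) (rG : is_repr G r).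
Hypotheses (subD : submod_closed [in D]).
Hypothesis GD : forall g v, G g -> D v -> D (r g v).
Hypothesis Du0 : ~ D u0.

Let admissible (M : set U) :=
  [/\ submod_closed [in M], forall g v, G g -> M v -> M (r g v), D `<=` M & ~ M u0].

Lemma maximal_admissible :
  exists M, admissible M /\ forall W, admissible W -> M `<=` W -> W `<=` M.
Proof.
(* The condition is put on the union with D because the empty chain also needs an upper bound: its
   union is empty, and adding D makes it admissible. *)
have [|A [PA maxA]] := @Zorn_bigcup U [set M | admissible (M `|` D)].
  move=> X XP totX; set S := \bigcup_(_ in X) _.
  have SE x y : (S `|` D) x -> (S `|` D) y ->
      exists W, [/\ admissible W, W `<=` S `|` D, W x & W y].
    have D1 : admissible D by split.
    have in1 M : X M -> M `|` D `<=` S `|` D by move=> XM z [Mz|]; [left; exists M | right].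
    move=> [[M XM Mx]|Dx] [[N XN Ny]|Dy].
    - have [MN|NM] := totX _ _ XM XN.
        by exists (N `|` D); split; [exact: XP | exact: in1 | left; exact: MN | left].
      by exists (M `|` D); split; [exact: XP | exact: in1 | left | left; exact: NM].
    - by exists (M `|` D); split; [exact: XP | exact: in1 | left | right].
    - by exists (N `|` D); split; [exact: XP | exact: in1 | right | left].
    - by exists D; split=> // z; right.
  split.
  - apply/submodP; split; first by right; have /submodP[] := subD.
    move=> c x y Sx Sy; have [W [[WS _ _ _] WSD Wx Wy]] := SE _ _ Sx Sy.
    by apply: WSD; have /submodP[_] := WS; apply.
  - move=> g v Gg Sv; have [W [[_ WG _ _] WSD Wv _]] := SE _ _ Sv Sv.
    by apply: WSD; exact: WG.
  - by move=> x; right.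
  - by move=> Su; have [W [[_ _ _ nW] _ Wu _]] := SE _ _ Su Su.
exists (A `|` D); split=> // W [W1 W2 W3 W4] AW x Wx.
have [//|nADx] := pselect ((A `|` D) x); exfalso; apply: (maxA W).
  by split=> [z Az|WA]; [apply: AW; left | apply: nADx; left; exact: WA].
by rewrite /=; have -> : W `|` D = W by apply/seteqP; split=> z; [case=> // /W3 | left].
Qed.

Let M := sval (cid maximal_admissible).
Let admM : admissible M. Proof. by have [] := svalP (cid maximal_admissible). Qed.
Let maxM W : admissible W -> M `<=` W -> W `<=` M.
Proof. by have [_] := svalP (cid maximal_admissible); apply. Qed.

Let C : set U := [set x | forall W : set U, submod_closed [in W] ->
  (forall g v, G g -> W v -> W (r g v)) -> M `<=` W -> W u0 -> W x].

Let subM : submod_closed [in M]. Proof. by case: admM. Qed.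
Let GM g v : G g -> M v -> M (r g v). Proof. by case: admM => _ + _ _; apply. Qed.
Let subC : submod_closed [in C].
Proof.
apply/submodP; split=> [W WS|c x y Cx Cy W WS GW MW Wu]; first by have /submodP[] := WS.
by have /submodP[_] := WS; apply; [exact: Cx | exact: Cy].
Qed.
Let GC g v : G g -> C v -> C (r g v).
Proof.
move=> Gg Cv W WS WG MW Wu; apply: (WG) => //.
exact: Cv WS WG MW Wu.
Qed.
Let MC : M `<=` C. Proof. by move=> x Mx W _ _ MW _; exact: MW. Qed.
Let Cu0 : C u0. Proof. by []. Qed.

Let V : lmodType F := subquotient subC subM MC.
Let pi : U -> V := subquotient_pi subC subM MC.

Let piP x y : C x -> C y -> pi x = pi y <-> M (x - y).
Proof. exact: subquotient_piP. Qed.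

Let piL c x y : C x -> C y -> pi (c *: x + y) = c *: pi x + pi y.
Proof. exact: subquotient_pi_linear. Qed.

Let pi_surj v : exists2 x, C x & pi x = v.
Proof. exact: subquotient_pi_surj. Qed.

Let lift v : U := s2val (cid2 (pi_surj v)).
Let liftC v : C (lift v). Proof. by rewrite /lift; case: cid2. Qed.
Let liftK v : pi (lift v) = v. Proof. by rewrite /lift; case: cid2. Qed.

Let act g v : V := if pselect (G g) then pi (r g (lift v)) else v.

Let act_pi g x : G g -> C x -> act g (pi x) = pi (r g x).
Proof.
move=> Gg Cx; rewrite /act; case: (pselect (G g)) => // Gg'.
apply/piP; [exact: GC | exact: GC | rewrite -linearB; apply: GM => //].
by apply/piP => //; rewrite liftK.
Qed.

Let act_linear g : linear (act g).
Proof.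
move=> c v w; have [Gg|nGg] := pselect (G g); last by rewrite /act; case: (pselect (G g)).
rewrite -(liftK v) -(liftK w) -piL // !act_pi //.
  by rewrite linearP piL //; exact: GC.
by have /submodP[_] := subC; apply.
Qed.

Let pi0 : pi 0 = 0.
Proof.
have C0 : C 0 by have /submodP[] := subC.
by have := piL (-1) C0 C0; rewrite scaler0 addr0 scaleN1r addNr.
Qed.

(** M is a maximal invariant subspace that contains D and misses u0, and C is the invariant subspace
    generated by M and u0. The preimage in C of an invariant subspace of C/M either contains u0, and
    then is C, or misses it, and then is M by maximality. *)
Lemma simple_subquotient :
  exists (V : lmodType F) (rho : gT -> {linear V -> V}) (C : set U) (pi : U -> V),
    [/\ is_repr G rho, repr_irreducible G rho, submod_closed [in C], C u0
      & forall g x, G g -> C x -> C (r g x)] /\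
    [/\ forall c x y, C x -> C y -> pi (c *: x + y) = c *: pi x + pi y,
        forall v, exists2 x, C x & pi x = v,
        forall x, C x -> D x -> pi x = 0, pi u0 != 0
      & forall g x, G g -> C x -> pi (r g x) = rho g (pi x)].
Proof.
pose rho g := linear_map (act_linear g).
have rhoE g x : G g -> C x -> rho g (pi x) = pi (r g x) by exact: act_pi.
have [r1 rM] := rG.
have C0 : C 0 by have /submodP[] := subC.
have Mu0 : ~ M u0 by case: admM.
have piu0 : pi u0 != 0.
  by apply/eqP; rewrite -pi0 => /(piP Cu0 C0); rewrite subr0.
have G1 : G 1%g by have [] := subG; rewrite inE.
exists V, rho, C, pi; split; split=> //.
- split=> [v|g h v Gg Gh].
    by rewrite -(liftK v) rhoE // r1.
  have Ggh : G (g * h)%g.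
    by have := group_closedM subG (mem_set Gg) (mem_set Gh); rewrite inE.
  by have := GC Gh (liftC v) => Chv; rewrite -(liftK v) !rhoE // rM.
- split; first by exists (pi u0).
  move=> W WS GW; pose W' := [set x | C x /\ W (pi x)].
  have subW' : submod_closed [in W'].
    apply/submodP; split; first by split=> //; rewrite pi0; have /submodP[] := WS.
    move=> c x y [Cx Wx] [Cy Wy]; split; first by have /submodP[_] := subC; apply.
    by rewrite piL //; have /submodP[_] := WS; apply.
  have GW' g x : G g -> W' x -> W' (r g x).
    by move=> Gg [Cx Wx]; split; [exact: GC | rewrite -rhoE //; exact: GW].
  have MW' : M `<=` W'.
    move=> x Mx; have Cx := MC Mx; split=> //.
    have -> : pi x = 0 by apply: (etrans _ pi0); apply/piP; rewrite ?subr0.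
    by have /submodP[] := WS.
  have [Wu|nWu] := pselect (W' u0).
    right; apply/seteqP; split=> // v _.
    by have /(_ W' subW' GW' MW' Wu) [_] := liftC v; rewrite liftK.
  left; apply/seteqP; split=> [v Wv|_ ->]; last by have /submodP[] := WS.
  have W'M : W' `<=` M by apply: maxM => //; split=> //; apply: subset_trans MW'; case: admM.
  have := liftC v => Cv; rewrite -(liftK v) /=; apply: (etrans _ pi0).
  by apply/piP; rewrite ?subr0 //; apply: W'M; split=> //; rewrite liftK.
- move=> x Cx Dx; apply: (etrans _ pi0); apply/piP; rewrite ?subr0 //.
  by case: admM => _ _ DM _; exact: DM.
- by move=> g x Gg Cx; rewrite rhoE.
Qed.

End SimpleSubquotient.

(** * Finite-dimensional representations *)

Section FiniteDimension.
Variables (F : fieldType) (V : lmodType F).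

(** A spanning family of least size is a basis, since a nontrivial relation would allow one vector
    to be eliminated. *)
Lemma finite_dimensional_coord : finite_dimensional F V ->
  exists n (crd : V -> 'cV[F]_n), linear crd /\ bijective crd.
Proof.
pose span n := `[< exists e : 'I_n -> V, forall v, exists c : 'I_n -> F, v = \sum_i c i *: e i >].
move=> fd; have exn : exists n, span n by have [n ?] := fd; exists n; exact/asboolP.
case: (ex_minnP exn) => n /asboolP[e eP] minn.
have free (c : 'I_n -> F) : \sum_i c i *: e i = 0 -> forall i, c i = 0.
  move=> c0 i; apply/eqP/negPn/negP => ci.
  have n0 : (0 < n)%N by rewrite (leq_ltn_trans _ (ltn_ord i)).
  suff /minn : span n.-1 by rewrite leqNgt ltn_predL n0.
  apply/asboolP; exists (fun j => e (fintype.lift i j)) => v.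
  have [d ->] := eP v; exists (fun j => d (fintype.lift i j) - d i / c i * c (fintype.lift i j)).
  transitivity (\sum_j (d j - d i / c i * c j) *: e j).
    under [RHS]eq_bigr do rewrite scalerBl -scalerA.
    by rewrite sumrB -scaler_sumr c0 scaler0 subr0.
  by rewrite (bigD1_ord i) //= divfK // subrr scale0r add0r.
have uniq (c d : 'I_n -> F) : \sum_i c i *: e i = \sum_i d i *: e i -> c =1 d.
  move=> cd i; apply/eqP; rewrite -subr_eq0; apply/eqP.
  apply: (free (fun i => c i - d i)); under eq_bigr do rewrite scalerBl.
  by rewrite sumrB cd subrr.
pose crd v : 'cV[F]_n := \col_i sval (cid (eP v)) i.
have crdE v : v = \sum_i crd v i ord0 *: e i.
  by rewrite {1}(svalP (cid (eP v))); apply: eq_bigr => i _; rewrite mxE.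
exists n, crd; split.
  move=> c u v; apply/colP => i.
  apply: (uniq (fun i => crd (c *: u + v) i ord0) (fun i => (c *: crd u + crd v) i ord0)).
  rewrite -crdE; under eq_bigr do rewrite !mxE scalerDl -scalerA.
  rewrite big_split /= -scaler_sumr; congr (_ *: _ + _); rewrite [LHS]crdE;
  by apply: eq_bigr => k _; rewrite mxE.
exists (fun x : 'cV_n => \sum_i x i ord0 *: e i) => [v|x]; first by rewrite -crdE.
apply/colP => i; apply: (uniq (fun i => crd _ i ord0) (fun i => x i ord0)).
by rewrite -crdE.
Qed.

End FiniteDimension.

Lemma matrix_of_linear (F : fieldType) n m (f : 'cV[F]_n -> 'cV[F]_m) : linear f ->
  exists A : 'M[F]_(m, n), forall x, f x = A *m x.
Proof.
move=> fL; pose fl := linear_map fL.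
exists (\matrix_(i, j) fl (delta_mx j ord0) i ord0) => x.
have -> : f x = fl (\sum_j x j ord0 *: delta_mx j ord0).
  congr f; apply/colP => i; rewrite summxE (bigD1 i) //= big1 ?addr0.
    by rewrite !mxE !eqxx mulr1.
  by move=> j /negPf ji; rewrite !mxE eq_sym ji mulr0.
rewrite linear_sum; apply/colP => i; rewrite summxE !mxE; apply: eq_bigr => j _.
by rewrite linearZ !mxE mulrC.
Qed.

Section Irreducible.
Variables (gT : groupType) (F : fieldType) (V : lmodType F) (G : set gT).
Variable rho : gT -> {linear V -> V}.
Hypotheses (subG : is_subgroup G) (rG : is_repr G rho) (irr : repr_irreducible G rho).

Lemma subgroup1 : G 1%g.
Proof. by have [] := subG; rewrite inE. Qed.

Lemma subgroupM g h : G g -> G h -> G (g * h)%g.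
Proof. by move=> /mem_set Gg /mem_set Gh; have := group_closedM subG Gg Gh; rewrite inE. Qed.

Lemma subgroupV g : G g -> G (g^-1)%g.
Proof. by move=> /mem_set Gg; have := group_closedV subG Gg; rewrite inE. Qed.

(** The span of the orbit is a nonzero invariant subspace, hence everything. *)
Lemma finite_orbit_dimension v0 : v0 != 0 ->
  finite_set [set rho g v0 | g in G] -> finite_dimensional F V.
Proof.
move=> v0N /finite_seqP[s sP].
pose e (i : 'I_(size s)) := s`_i.
exists (size s), e => v.
pose W := [set v | exists c : 'I_(size s) -> F, v = \sum_i c i *: e i].
have ind g : G g -> exists i, rho g v0 = e i.
  move=> Gg; have /(nthP 0)[i si <-] : rho g v0 \in s.
    by have : [set` s] (rho g v0) by rewrite -sP; exists g.
  by exists (Ordinal si).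
have We i : W (e i).
  exists (fun j => (i == j)%:R); rewrite (bigD1 i) //= eqxx scale1r big1 ?addr0 //.
  by move=> j; rewrite eq_sym => /negPf ->; rewrite scale0r.
have WS : submod_closed [in W].
  apply/submodP; split.
    by exists (fun=> 0); rewrite big1 // => i _; rewrite scale0r.
  move=> c x y [a ->] [b ->]; exists (fun i => c * a i + b i).
  under [RHS]eq_bigr do rewrite scalerDl -scalerA.
  by rewrite big_split scaler_sumr.
have GW g x : G g -> W x -> W (rho g x).
  move=> Gg [c ->]; rewrite linear_sum; apply: submod_sum => // i _.
  rewrite linearZ; apply: submod_scale => //.
  have : [set` s] (e i) by exact: mem_nth.
  rewrite -sP => -[h Gh <-]; have [_ rM] := rG; rewrite -rM //.
  by have [j ->] := ind _ (subgroupM Gg Gh).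
have [_ /(_ W WS GW)[W0|WT]] := irr; last by rewrite -[exists c, _]/(W v) WT.
have [i rv] := ind _ subgroup1.
have := We i; rewrite -rv W0 => /= r0; have [r1 _] := rG.
by move: v0N; rewrite -(r1 v0) r0 eqxx.
Qed.

End Irreducible.

Lemma finite_image_quotient (gT : groupType) (T : Type) (G N : set gT) (f : gT -> T) :
  finite_set (quotient_set G N) -> N 1%g -> (forall g x, G g -> N x -> f (g * x)%g = f g) ->
  finite_set (f @` G).
Proof.
move=> fin N1 fN.
apply: (sub_finite_set _ (finite_image (fun A => f (xget 1%g A)) fin)).
move=> _ [g Gg <-]; exists [set (g * x)%g | x in N]; first by exists g.
have : [set (g * x)%g | x in N] (xget 1%g [set (g * x)%g | x in N]).
  by apply: xgetPex; exists (g * 1)%g; exists 1%g.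
by move=> [x Nx <-]; rewrite fN.
Qed.

(** If the kernel is nontrivial then it has finite index by just infiniteness, so every orbit is
    finite and [finite_orbit_dimension] bounds the dimension. *)
Lemma infinite_irreducible_faithful (gT : groupType) (F : fieldType) (V : lmodType F)
    (G : set gT) (rho : gT -> {linear V -> V}) :
  is_subgroup G -> just_infinite G -> is_repr G rho -> repr_irreducible G rho ->
  ~ finite_dimensional F V -> repr_faithful G rho.
Proof.
move=> subG [_ jiG] rG irr infd; have [r1 rM] := rG; have [v0N WT] := irr.
pose N := [set g | G g /\ forall v, rho g v = v].
have G1 := subgroup1 subG.
have rV g v : G g -> rho (g^-1)%g (rho g v) = v.
  by move=> Gg; rewrite -rM ?mulVg //; exact: subgroupV.
have rVr g v : G g -> rho g (rho (g^-1)%g v) = v.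
  by move=> Gg; rewrite -rM ?mulgV //; exact: subgroupV.
have normN : normal_in N G.
  split.
  - split; first by rewrite inE.
    move=> g h; rewrite !inE => -[Gg gv] [Gh hv]; split.
      by apply: subgroupM => //; exact: subgroupV.
    move=> v; rewrite rM //; last exact: subgroupV.
    by rewrite gv -{1}(hv v) rV.
  - by move=> g [].
  - move=> x g [Gx xv] Gg; have GV := subgroupV subG Gg; split.
      by rewrite conjgE; do 2?apply: subgroupM.
    by move=> v; rewrite conjgE !rM ?xv ?rV //; apply: subgroupM.
have N1 : N = [set 1%g].
  apply: contra_notP infd => /(jiG _ normN) fin.
  have [v0 v0N0] := v0N.
  apply: (finite_orbit_dimension subG rG irr v0N0).
  apply: (finite_image_quotient fin); first by split.
  by move=> g x Gg [Gx xv]; rewrite rM // xv.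
move=> g h Gg Gh gh.
have : N (g * h^-1)%g.
  split; first by apply: subgroupM => //; exact: subgroupV.
  by move=> v; rewrite rM ?gh ?rVr //; exact: subgroupV.
by rewrite N1 => /= /(canRL (mulgK _)); rewrite invgK mul1g.
Qed.

(** * The eigenvector *)

Section WordFunctions.
Variable p : nat.

(* Functions on the vertices of the tree; an automorphism acts on them by        *)
(* (g f)(w) = f (w g), which turns the right action on vertices into a left one. *)
Definition word_function : lmodType 'F_p := seq 'I_p -> ('F_p)^o.

Definition word_act_fun (g : tree_aut p) (f : word_function) : word_function := f \o g.

Lemma word_act_linear g : linear (word_act_fun g).
Proof. by []. Qed.

Definition word_act g := linear_map (word_act_linear g).

Lemma word_act_repr G : is_repr G word_act.
Proof. by split=> *; apply: funext. Qed.

(* The augmentation ideal acts nilpotently on the functions on each finite level, *)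
(* but not on the quotient of all functions by this subspace.                     *)
Definition ray_null : set word_function :=
  [set f | forall xi : boundary p, exists n0, forall n, (n0 <= n)%N -> f (xi n) = 0].

Lemma ray_null_submod : submod_closed [in ray_null].
Proof.
apply/submodP; split=> [xi|c f g f0 g0 xi]; first by exists 0%N.
have [[m fm] [n gn]] := (f0 xi, g0 xi); exists (maxn m n) => k.
rewrite geq_max => /andP[mk nk]; rewrite -[LHS]/(c *: f (xi k) + g (xi k)).
by rewrite fm // gn // scaler0 addr0.
Qed.

Lemma word_act_ray_null g f : ray_null f -> ray_null (word_act g f).
Proof.
by move=> f0 xi; have [n0 h] := f0 (boundary_act g xi); exists n0 => n /h.
Qed.

Lemma ray_size (xi : boundary p) n : size (xi n) = n.
Proof.
have [x0 xE] : is_ray xi by case: xi => r /= /asboolP.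
by elim: n => [|n IH]; [rewrite x0 | have /tree_edgeP[y ->] := xE n; rewrite size_rcons IH].
Qed.

Lemma ray_take (xi : boundary p) m n : (m <= n)%N -> take m (xi n) = xi m.
Proof.
have [_ xE] : is_ray xi by case: xi => r /= /asboolP.
elim: n => [|n IH]; first by rewrite leqn0 => /eqP->; rewrite -[X in take X _](ray_size xi) take_size.
rewrite leq_eqVlt => /orP[/eqP->|]; first by rewrite -[X in take X _](ray_size xi n.+1) take_size.
rewrite ltnS => mn; have /tree_edgeP[y ->] := xE n.
by rewrite -cats1 takel_cat ?ray_size // IH.
Qed.

Lemma ray_of_word (x : nat -> 'I_p) : exists xi : boundary p, forall n, xi n = mkseq x n.
Proof.
suff H : `[< is_ray (mkseq x) >] by exists (Boundary H).
apply/asboolP; split=> // n; apply/tree_edgeP; exists (x n).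
by rewrite /mkseq -addn1 iotaD map_cat cats1.
Qed.

End WordFunctions.

(** * Letters modulo p, and the orders of the generators *)

Section Letters.
Variable p : nat.
Hypothesis p_prime : prime p.

Lemma iter_ordS k (x : 'I_p) : iter k (@ordS p) x = ((x + k) %% p)%N :> nat.
Proof.
elim: k => [|k IH] /=; first by rewrite addn0 modn_small.
by rewrite IH -addn1 modnDml addn1 addnS.
Qed.

Lemma iter_ordS_eq k l (x : 'I_p) : (iter k (@ordS p) x == iter l (@ordS p) x) = (k == l %[mod p])%N.
Proof. by rewrite -val_eqE /= !iter_ordS eqn_modDl. Qed.

(** Multiplication by m is a bijection modulo p, so x + mk runs through all letters as k does. *)
Lemma sum_iter_ordS (R : nmodType) (F : 'I_p -> R) m (x : 'I_p) : ~~ (p %| m)%N ->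
  \sum_(k < p) F (iter (m * k) (@ordS p) x) = \sum_y F y.
Proof.
move=> pm; rewrite [RHS](reindex_inj (h := fun k : 'I_p => iter (m * k) (@ordS p) x)) //.
move=> k l /eqP; rewrite iter_ordS_eq => /eqP kl; apply: val_inj.
wlog lk : k l kl / (l <= k)%N.
  by move=> W; have /orP[] := leq_total l k => h; [|apply/esym]; apply: W.
have: (p %| m * k - m * l)%N by rewrite -eqn_mod_dvd ?leq_mul2l ?lk ?orbT //; apply/eqP.
rewrite -mulnBr Euclid_dvdM // (negPf pm) /= => /dvdn_leq.
have := ltn_ord k; lia.
Qed.

(** [spinal_index j] is a bijection from the alphabet onto the entries of e together with [None]. *)
Lemma sum_spinal_index (R : nmodType) j (F : option 'I_p.-1 -> R) :
  \sum_x F (spinal_index j x) = F None + \sum_t F (Some t).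
Proof.
transitivity (\sum_(y < p) F (insub (val y))).
  rewrite [RHS](reindex_inj (h := fun x : 'I_p => iter j (@ordS p) x)).
    by apply: eq_bigr => x _; rewrite /spinal_index /= iter_ordS addnC.
  by elim: (j) => // k IH x y /(can_inj (@ordSK p))/IH.
rewrite -(big_mkord xpredT (fun y => F (insub y))).
rewrite -[X in index_iota 0 X](prednK (prime_gt0 p_prime)) big_nat_recr //= insubN ?ltnn //.
rewrite addrC; congr (_ + _); rewrite big_mkord; apply: eq_bigr => t _.
by rewrite valK.
Qed.

Lemma rooted_exp k (x : 'I_p) w : (rooted p ^+ k)%g (x :: w) = iter k (@ordS p) x :: w.
Proof.
elim: k => [|k IH] //; rewrite expgSr -[LHS]/(rooted p ((rooted p ^+ k)%g (x :: w))).
by rewrite IH.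
Qed.

Lemma rooted_expp : (rooted p ^+ p)%g = 1%g.
Proof.
apply: tree_aut_eq => -[|x w]; first by rewrite !tree_aut_nil.
rewrite rooted_exp; congr cons; apply: val_inj.
by rewrite /= iter_ordS modnDr modn_small.
Qed.

Lemma spinal_exp j (e : 'rV['F_p]_p.-1) k (x : 'I_p) w : (spinal j e ^+ k)%g (x :: w) =
  x :: if spinal_index j x is Some t then (rooted p ^+ (e ord0 t * k))%g w
       else (spinal j e ^+ k)%g w.
Proof.
elim: k w => [|k IH] w; first by case: spinal_index => // t; rewrite muln0.
rewrite expgSr -[LHS]/(spinal j e ((spinal j e ^+ k)%g (x :: w))) IH /=.
by case: spinal_index => [t|//]; rewrite mulnS addnC expgnDr.
Qed.

Lemma spinal_expp j (e : 'rV['F_p]_p.-1) : (spinal j e ^+ p)%g = 1%g.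
Proof.
apply: tree_aut_eq; elim=> [|x w IH]; first by rewrite !tree_aut_nil.
rewrite spinal_exp IH; case: spinal_index => [t|//].
by rewrite mulnC expgnA rooted_expp expg1n.
Qed.

Lemma Fp_val_lt (x : 'F_p) : (x < p)%N.
Proof. by rewrite -[X in (_ < X)%N]Fp_cast. Qed.

Lemma Fp_dvd (x : 'F_p) : (p %| x)%N = (x == 0).
Proof.
rewrite -val_eqE /=; apply/idP/eqP => [|->//]; have := Fp_val_lt x.
move=> xp; case: (posnP x) => // x0 /(dvdn_leq x0); lia.
Qed.

Lemma Fp_pnat0 : p%:R = 0 :> 'F_p.
Proof. exact: pchar_Fp_0. Qed.

End Letters.

Section Eigenvector.
Variables (p j : nat) (e : 'rV['F_p]_p.-1).
Hypotheses (p_prime : prime p) (e0 : e != 0).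

Let nz := [pred t | e ord0 t != 0].
Let r : 'F_p := (#|nz|)%:R.
Local Notation a := (rooted p).
Local Notation b := (spinal j e).

Let r0 : r != 0.
Proof.
have c1 : (#|nz| < p)%N.
  rewrite (leq_ltn_trans (max_card _)) // card_ord ltn_predL; exact: prime_gt0.
have c0 : (0 < #|nz|)%N.
  rewrite lt0n; apply: contra e0 => /eqP/card0_eq E0; apply/eqP/rowP => t.
  by have := E0 t; rewrite !inE mxE => /negPn/eqP.
rewrite /r -(dvdn_pcharf (pchar_Fp p_prime)); apply/negP => /(dvdn_leq c0).
by rewrite leqNgt c1.
Qed.

(* The pair (Y w, Z w), where Z is to be the sum of the translates of Y by the *)
(* powers of a.                                                                *)
Fixpoint eigen_pair (w : seq 'I_p) : 'F_p * 'F_p :=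
  if w is x :: w' then
    let: (y, z) := eigen_pair w' in
    (if spinal_index j x is Some t then if e ord0 t == 0 then 0 else r^-1 * z else y, y + z)
  else (0, 1).

Let Y w := (eigen_pair w).1.
Let Z w := (eigen_pair w).2.

Let YE x w : Y (x :: w) =
  if spinal_index j x is Some t then if e ord0 t == 0 then 0 else r^-1 * Z w else Y w.
Proof. by rewrite /Y /Z /=; case: eigen_pair. Qed.

Let ZE x w : Z (x :: w) = Y w + Z w.
Proof. by rewrite /Y /Z /=; case: eigen_pair. Qed.

Let sumA (f : seq 'I_p -> 'F_p) w := \sum_(k < p) f ((a ^+ k)%g w).
Let sumB (f : seq 'I_p -> 'F_p) w := \sum_(k < p) f ((b ^+ k)%g w).

Let sum_const (c : 'F_p) : \sum_(k < p) c = 0.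
Proof. by rewrite sumr_const card_ord -mulr_natr Fp_pnat0 ?mulr0. Qed.

Let sumA_cons f x w : sumA f (x :: w) = \sum_y f (y :: w).
Proof.
rewrite -(@sum_iter_ordS p p_prime _ (fun y => f (y :: w)) 1 x).
  by apply: eq_bigr => k _; rewrite mul1n rooted_exp.
by rewrite Euclid_dvd1.
Qed.

Let sumA_nil f : sumA f [::] = 0.
Proof. by rewrite /sumA; under eq_bigr do rewrite tree_aut_nil; exact: sum_const. Qed.

Let sumA_exp f (m : 'F_p) w : m != 0 -> \sum_(k < p) f ((a ^+ (m * k))%g w) = sumA f w.
Proof.
case: w => [|x w] m0; first by rewrite sumA_nil; under eq_bigr do rewrite tree_aut_nil; exact: sum_const.
rewrite sumA_cons -(@sum_iter_ordS p p_prime _ (fun y => f (y :: w)) m x).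
  by apply: eq_bigr => k _; rewrite rooted_exp.
by rewrite Fp_dvd.
Qed.

Let sumB_cons f x w : sumB f (x :: w) =
  if spinal_index j x is Some t then
    if e ord0 t == 0 then 0 else sumA (fun w => f (x :: w)) w
  else sumB (fun w => f (x :: w)) w.
Proof.
rewrite /sumB; under eq_bigr do rewrite spinal_exp.
case: spinal_index => [t|//]; have [->|t0] := eqVneq (e ord0 t) 0.
  by under eq_bigr do rewrite mul0n; exact: sum_const.
by rewrite (sumA_exp (fun w => f (x :: w))).
Qed.

Let sumA_Y x w : sumA Y (x :: w) = Z (x :: w).
Proof.
rewrite sumA_cons ZE; under eq_bigr do rewrite YE.
rewrite (@sum_spinal_index p p_prime _ j (fun o => if o is Some t then
  (if e ord0 t == 0 then 0 else r^-1 * Z w) else Y w)).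
congr (_ + _); rewrite (bigID (fun t => e ord0 t != 0)) /= [X in _ + X]big1 ?addr0; last first.
  by move=> t /negPn ->.
rewrite (eq_bigr (fun=> r^-1 * Z w)); last by move=> t /negPf ->.
rewrite (eq_bigl [in nz]); last by move=> t; rewrite inE.
by rewrite sumr_const -mulr_natl -/r mulVKf.
Qed.

Let sumA_Z w : sumA Z w = 0.
Proof.
case: w => [|x w]; first exact: sumA_nil.
by rewrite sumA_cons; under eq_bigr do rewrite ZE; exact: sum_const.
Qed.

Let sumB_Y w : sumB Y w = 0.
Proof.
elim: w => [|x w IH]; first by rewrite /sumB; under eq_bigr do rewrite tree_aut_nil; exact: sum_const.
rewrite sumB_cons; case E: spinal_index => [t|].
  case: eqP => // t0; rewrite /sumA; under eq_bigr do rewrite YE E (introF eqP t0).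
  by rewrite -mulr_sumr -[X in _ * X]/(sumA Z w) sumA_Z mulr0.
by rewrite -[RHS]IH; apply: eq_bigr => k _; rewrite YE E.
Qed.

(** The words made of repetitions of the letter at which b recurs, followed by one other letter.
    There b acts by a power of a on the empty word, so that p equal terms cancel, and [sumB Z] may
    differ from [r * Y]. *)
Let exceptional (w : seq 'I_p) := if w is x :: w' then
  (spinal_index j (last x w') != None) && all (fun y => spinal_index j y == None) (belast x w')
  else false.

Let sumB_Z w : ~~ exceptional w -> sumB Z w = r * Y w.
Proof.
elim: w => [|x w IH] /=.
  transitivity (\sum_(k < p) (1 : 'F_p)); last by rewrite sum_const mulr0.
  by apply: eq_bigr => k _; rewrite tree_aut_nil.
move=> nx; rewrite sumB_cons YE; case E: (spinal_index j x) nx => [t|] nx; last first.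
  transitivity (sumB Y w + sumB Z w).
    by rewrite /sumA /sumB -big_split; apply: eq_bigr => k _; rewrite ZE.
  rewrite sumB_Y add0r; apply: IH.
  by apply: contra nx; case: (w) => //= y v /andP[-> ->]; rewrite E.
have wN : w <> [::] by move=> w0; move: nx; rewrite w0 /= E.
case: eqP => [_|t0]; first by rewrite mulr0.
rewrite mulrA divff // mul1r; transitivity (sumA Y w + sumA Z w).
  by rewrite /sumA /sumB -big_split; apply: eq_bigr => k _; rewrite ZE.
rewrite sumA_Z addr0.
by case: (w) wN => // y v _; rewrite sumA_Y.
Qed.

(** Off the root, [sumA Y] is Z; off the root and the exceptional words, [sumB Z] is [r * Y]. A ray
    meets at most one exceptional word, so the error is null along rays. Y itself is not: it equals
    the inverse of r along the ray x, o, o, ..., where b has a nontrivial power of a at x and recurs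
    at o. *)
Lemma eigenvector : exists (lam : 'F_p) (f : word_function p),
  ~ ray_null f /\
  ray_null (lam *: (\sum_(l < p) \sum_(k < p) word_act (b ^+ l * a ^+ k)%g f) - f).
Proof.
exists r^-1, Y; split.
  have p0 := prime_gt0 p_prime.
  have [t t0] : exists t, e ord0 t != 0.
    apply/existsP; apply: contraNT e0 => /existsPn H.
    by apply/eqP/rowP => t; rewrite mxE; apply/eqP/negPn.
  have idx (y : nat) : (y < p)%N -> exists x : 'I_p, ((j + x) %% p = y)%N.
    (* The letter y - j modulo p, with -1 written as p - 1. *)
    move=> yp; exists (iter (y + p.-1 * j) (@ordS p) (Ordinal p0)).
    by rewrite iter_ordS add0n modnDmr addnCA -mulSn prednK // mulnC addnC modnMDl modn_small.
  have [x xE] := idx t (leq_trans (ltn_ord t) (leq_pred _)).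
  have [o oE] := idx p.-1 ltac:(by rewrite ltn_predL).
  have sx : spinal_index j x = Some t by rewrite /spinal_index xE valK.
  have so : spinal_index j o = None by rewrite /spinal_index oE insubN // ltnn.
  have [xi xiE] := ray_of_word (fun n => if n is 0%N then x else o).
  have mk n : mkseq (fun n => if n is 0%N then x else o) n.+1 = x :: nseq n o.
    apply: (@eq_from_nth _ o) => [|i]; rewrite size_mkseq /= ?size_nseq // => ni.
    by rewrite nth_mkseq //; case: i ni => //= i _; rewrite nth_nseq if_same.
  have yz n : Y (nseq n o) = 0 /\ Z (nseq n o) = 1.
    by elim: n => //= n [Yn Zn]; rewrite YE ZE so Yn Zn add0r.
  move=> /(_ xi)[n0 /(_ n0.+1 (leqnSn _))].
  rewrite xiE mk YE sx (negPf t0) (yz _).2 mulr1 => /eqP; rewrite invr_eq0.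
  by rewrite (negPf r0).
move=> xi.
have opE w : (r^-1 *: (\sum_(l < p) \sum_(k < p) word_act (b ^+ l * a ^+ k)%g Y) - Y) w
    = r^-1 * sumB (sumA Y) w - Y w.
  rewrite -[LHS]/(r^-1 * (\sum_(l < p) \sum_(k < p) word_act (b ^+ l * a ^+ k)%g Y) w - Y w).
  congr (_ * _ - _); rewrite fct_sumE; apply: eq_bigr => l _.
  by rewrite fct_sumE.
have good w : w != [::] -> ~~ exceptional w ->
    (r^-1 *: (\sum_(l < p) \sum_(k < p) word_act (b ^+ l * a ^+ k)%g Y) - Y) w = 0.
  move=> wN we; rewrite opE.
  suff -> : sumB (sumA Y) w = r * Y w by rewrite mulKf // subrr.
  rewrite -sumB_Z //; apply: eq_bigr => l _.
  case: w wN {we} => // x w _; rewrite spinal_exp; exact: sumA_Y.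
have [[m me]|ne] := pselect (exists m, exceptional (xi m)); last first.
  exists 1%N => n n1; apply: good; first by rewrite -size_eq0 ray_size -lt0n.
  by apply/negP => ?; apply: ne; exists n.
exists m.+1 => n mn; apply: good; first by rewrite -size_eq0 ray_size -lt0n (leq_trans _ mn).
(* Below an exceptional vertex no vertex is exceptional: the letter other than o is no longer the
   last one. *)
have : take m (xi n) = xi m by rewrite ray_take // ltnW.
move=> tk; rewrite -(cat_take_drop m (xi n)) tk.
have : drop m (xi n) != [::] by rewrite -size_eq0 size_drop ray_size subn_eq0 -ltnNge.
case: (xi m) me => // x w /= /andP[wl _]; case: (drop _ _) => // z v _.
by rewrite /= belast_cat all_cat /= (negPf wl) !andbF.
Qed.

End Eigenvector.

(** * First-level sections *)

Section Generation.
Variable gT : groupType.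
Implicit Types A H : set gT.

Lemma subgroupP H : is_subgroup H <-> H 1%g /\ forall g h, H g -> H h -> H (g / h)%g.
Proof.
split=> -[H1 HD]; split.
- by move: H1; rewrite inE.
- by move=> g h Hg Hh; move: (HD g h); rewrite !inE; apply.
- by rewrite inE.
- by move=> g h; rewrite !inE; exact: HD.
Qed.

Lemma generated_subgroup A : is_subgroup (generated A).
Proof.
apply/subgroupP; split=> [H [/subgroupP[]]|g h Ag Ah H [HS AH]] //.
by have /subgroupP[_] := HS; apply; [exact: Ag | exact: Ah].
Qed.

Lemma sub_generated A : A `<=` generated A.
Proof. by move=> g Ag H [_]; apply. Qed.

Lemma generated_min A H : is_subgroup H -> A `<=` H -> generated A `<=` H.
Proof. by move=> HS AH g; apply. Qed.

Lemma subgroupX H g n : is_subgroup H -> H g -> H (g ^+ n)%g.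
Proof.
move=> HS Hg; elim: n => [|n IH]; first exact: subgroup1.
by rewrite expgS; exact: subgroupM.
Qed.

Lemma subgroupJ H g h : is_subgroup H -> H g -> H h -> H (g ^ h)%g.
Proof.
by move=> HS Hg Hh; rewrite conjgE; do 2?apply: subgroupM => //; exact: subgroupV.
Qed.

Lemma subgroupR H g h : is_subgroup H -> H g -> H h -> H [~ g, h]%g.
Proof. by move=> HS Hg Hh; rewrite commgEl; apply: subgroupM; [|exact: subgroupV|exact: subgroupJ]. Qed.

Definition derived H := generated [set k | exists g h, [/\ H g, H h & k = [~ g, h]%g]].

Lemma derivedR H g h : H g -> H h -> derived H [~ g, h]%g.
Proof. by move=> Hg Hh; apply: sub_generated; exists g, h. Qed.

Lemma derived_sub H : is_subgroup H -> derived H `<=` H.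
Proof. by move=> HS; apply: generated_min => // _ [g [h [Hg Hh ->]]]; exact: subgroupR. Qed.

Lemma powers_subgroup (a : gT) n : (a ^+ n)%g = 1%g -> (0 < n)%N ->
  is_subgroup [set g | exists m, g = (a ^+ m)%g].
Proof.
move=> an n0; apply/subgroupP; split=> [|_ _ [k ->] [l ->]]; first by exists 0%N.
exists (k + n.-1 * l)%N; rewrite expgnDr; congr (_ * _)%g; apply: (mulgI (a ^+ l)%g).
by rewrite mulgV -expgnDr -mulSn prednK // expgnA an expg1n.
Qed.

End Generation.

Section FirstLevel.
Variable p : nat.
Implicit Types g h : tree_aut p.

Lemma stab1_cons g x w : stab1 g -> g (x :: w) = x :: psi1 g x w.
Proof. by move=> gS; rewrite tree_aut_head gS. Qed.

Lemma stab1_eq g h : stab1 g -> stab1 h -> psi1 g =1 psi1 h -> g = h.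
Proof.
move=> gS hS gh; apply: tree_aut_eq => -[|x w]; first by rewrite !tree_aut_nil.
by rewrite !stab1_cons // gh.
Qed.

Lemma stab1M g h : stab1 g -> stab1 h -> stab1 (g * h)%g.
Proof. by move=> gS hS x; rewrite -[LHS]/(h (g [:: x])) gS hS. Qed.

Lemma tree_invK g w : (g^-1)%g (g w) = w.
Proof. by have := mulgV g => /(congr1 (fun k : tree_aut p => k w)). Qed.

Lemma tree_invKr g w : g ((g^-1)%g w) = w.
Proof. by have := mulVg g => /(congr1 (fun k : tree_aut p => k w)). Qed.

Lemma stab1V g : stab1 g -> stab1 (g^-1)%g.
Proof. by move=> gS x; rewrite -{1}(gS x) tree_invK. Qed.

Lemma psi1_1 x : psi1 (1%g : tree_aut p) x = 1%g.
Proof. exact: tree_aut_eq. Qed.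

Lemma psi1M g h x : stab1 g -> psi1 (g * h)%g x = (psi1 g x * psi1 h x)%g.
Proof.
move=> gS; apply: tree_aut_eq => w /=; rewrite stab1_cons //=.
Qed.

Lemma psi1V g x : stab1 g -> psi1 (g^-1)%g x = (psi1 g x)^-1%g.
Proof.
by move=> gS; apply: (mulgI (psi1 g x)); rewrite -psi1M // !mulgV psi1_1.
Qed.

Lemma psi1R g h x : stab1 g -> stab1 h -> psi1 [~ g, h]%g x = [~ psi1 g x, psi1 h x]%g.
Proof.
move=> gS hS; have [gV hV] := (stab1V gS, stab1V hS).
by rewrite !commgEl !conjgE !psi1M ?psi1V //; apply: stab1M.
Qed.

Lemma stab1R g h : stab1 g -> stab1 h -> stab1 [~ g, h]%g.
Proof.
move=> gS hS; have [gV hV] := (stab1V gS, stab1V hS).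
by rewrite !commgEl !conjgE; do 3?apply: stab1M.
Qed.

Lemma stab1X g n : stab1 g -> stab1 (g ^+ n)%g.
Proof. by move=> gS; elim: n => // n IH; rewrite expgS; exact: stab1M. Qed.

Lemma psi1X g n x : stab1 g -> psi1 (g ^+ n)%g x = (psi1 g x ^+ n)%g.
Proof.
move=> gS; elim: n => [|n IH]; first exact: psi1_1.
by rewrite !expgS psi1M // IH.
Qed.

Lemma tree_size g w : size (g w) = size w.
Proof.
elim/last_ind: w => [|w x IH]; first by rewrite tree_aut_nil.
by have [y ->] := tree_aut_rcons g w x; rewrite !size_rcons IH.
Qed.

Lemma tree_take g w v : take (size w) (g (w ++ v)) = g w.
Proof.
elim/last_ind: v => [|v x IH]; first by rewrite cats0 -(tree_size g) take_size.
rewrite -rcons_cat; have [y ->] := tree_aut_rcons g (w ++ v) x.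
by rewrite -cats1 takel_cat ?IH // tree_size size_cat leq_addr.
Qed.

Lemma psi1_conj_rooted g k x : stab1 g ->
  psi1 (g ^ (rooted p ^+ k))%g (iter k (@ordS p) x) = psi1 g x.
Proof.
move=> gS; apply: tree_aut_eq => w.
have H : ((rooted p ^+ k)^-1)%g (iter k (@ordS p) x :: w) = x :: w.
  by rewrite -rooted_exp tree_invK.
rewrite conjgE -[LHS]/(behead ((rooted p ^+ k)%g (g (((rooted p ^+ k)^-1)%g (iter k (@ordS p) x :: w))))).
by rewrite H stab1_cons // rooted_exp.
Qed.

Lemma stab1_conj_rooted g k : stab1 g -> stab1 (g ^ (rooted p ^+ k))%g.
Proof.
move=> gS x; rewrite conjgE -[LHS]/((rooted p ^+ k)%g (g (((rooted p ^+ k)^-1)%g [:: x]))).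
have : size (((rooted p ^+ k)^-1)%g [:: x]) = 1%N by rewrite tree_size.
case E: (_ [:: x]) => [|y []] // _.
by rewrite gS -E tree_invKr.
Qed.

End FirstLevel.

(** * Weak branching *)

Section WeaklyBranch.
Variables (p j : nat) (e : 'rV['F_p]_p.-1).
Hypothesis p_prime : prime p.
Local Notation a := (rooted p).
Local Notation b := (spinal j e).
Local Notation sh := (@ordS p).

Let bS : stab1 b. Proof. exact: spinal_stab1. Qed.

Lemma spinal_index_None : exists o : 'I_p, forall x : 'I_p, (spinal_index j x == None) = (x == o).
Proof.
have p0 := prime_gt0 p_prime.
have [o oE] : exists o : 'I_p, ((j + o) %% p = p.-1)%N.
  exists (iter (p.-1 + p.-1 * j) (@ordS p) (Ordinal p0)).
  by rewrite iter_ordS add0n modnDmr addnCA -mulSn prednK // mulnC addnC modnMDl modn_small // ltn_predL.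
exists o => x; rewrite /spinal_index; case: insubP => [t tp _|xp].
  by apply/esym/negbTE; apply: contraTneq tp => ->; rewrite oE ltnn.
apply/esym/eqP; have : ((j + x) %% p == (j + o) %% p)%N.
  have := ltn_pmod (j + x) p0; rewrite oE; move: xp; rewrite -leqNgt; lia.
by rewrite eqn_modDl !modn_small // => /eqP/val_inj.
Qed.

Definition spinal_pos := sval (cid spinal_index_None).
Local Notation o := spinal_pos.

Lemma spinal_index_eqNone x : (spinal_index j x == None) = (x == o).
Proof. by rewrite (svalP (cid spinal_index_None)). Qed.

Lemma iter_ordS_onto (x y : 'I_p) : exists k, iter k sh x = y.
Proof.
exists (y + (p - x))%N; apply: val_inj; rewrite /= iter_ordS addnCA subnKC; last exact: ltnW.
by rewrite modnDr modn_small.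
Qed.

Lemma rooted_exp_eq k l (o : 'I_p) : iter k sh o = iter l sh o -> (a ^+ k = a ^+ l)%g.
Proof.
move=> /eqP; rewrite iter_ordS_eq => /eqP kl; apply: tree_aut_eq => -[|x w].
  by rewrite !tree_aut_nil.
by rewrite !rooted_exp; congr cons; apply/eqP; rewrite iter_ordS_eq kl.
Qed.

Let bo : psi1 b o = b.
Proof. by rewrite psi1_spinal; have /eqP -> : spinal_index j o == None by rewrite spinal_index_eqNone. Qed.
Let bN x : x != o -> exists m, psi1 b x = (a ^+ m)%g.
Proof.
rewrite -spinal_index_eqNone psi1_spinal; case: spinal_index => // t _.
by exists (e ord0 t).
Qed.

(* For this conjugate of b, the coordinate in which b itself occurs is x. *)
Definition spinal_at (x : 'I_p) : tree_aut p := (b ^ (a ^+ sval (cid (iter_ordS_onto o x))))%g.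
Local Notation c := spinal_at.

Lemma spinal_atE k : c (iter k sh o) = (b ^ (a ^+ k))%g.
Proof.
rewrite /c; case: cid => l /= lE; congr (b ^ _)%g; exact: (@rooted_exp_eq _ _ o).
Qed.

Lemma spinal_at_pos : c o = b.
Proof. by rewrite -[in LHS]/(iter 0 sh o) spinal_atE conjg1. Qed.

Lemma spinal_at_conj k x : c (iter k sh x) = (c x ^ (a ^+ k))%g.
Proof. by have [l <-] := iter_ordS_onto o x; rewrite -iterD !spinal_atE addnC expgnDr conjgM. Qed.

Let cP x (P : 'I_p -> tree_aut p -> Prop) :
  (forall k, P (iter k sh o) (b ^ (a ^+ k))%g) -> P x (c x).
Proof. by have [k <-] := iter_ordS_onto o x; rewrite spinal_atE. Qed.

Lemma spinal_at_stab1 x : stab1 (c x).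
Proof. by apply: (@cP _ (fun _ g => stab1 g)) => k; exact: stab1_conj_rooted. Qed.
Let cS := spinal_at_stab1.

Lemma psi1_spinal_at x : psi1 (c x) x = b.
Proof. by apply: (@cP _ (fun x g => psi1 g x = b)) => k; rewrite psi1_conj_rooted. Qed.

Lemma psi1_spinal_at_neq x y : y != x -> exists m, psi1 (c x) y = (a ^+ m)%g.
Proof.
apply: (@cP _ (fun x g => y != x -> exists m, psi1 g y = (a ^+ m)%g)) => k yk.
have [l yE] : exists l, y = iter k sh (iter l sh o).
  have [l lE] := iter_ordS_onto (iter k sh o) y.
  by exists l; rewrite -lE -!iterD addnC.
rewrite yE psi1_conj_rooted //; apply: bN; apply: contra yk.
by rewrite yE => /eqP->.
Qed.

Lemma psi1_spinal_at_shift k x y : psi1 (c (iter k sh x)) (iter k sh y) = psi1 (c x) y.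
Proof.
by rewrite spinal_at_conj psi1_conj_rooted //; exact: spinal_at_stab1.
Qed.

Hypotheses (p_odd : odd p) (e0 : e != 0).

Lemma spinal_nontrivial_section : exists x m, psi1 b x = (a ^+ m)%g /\ ~~ (p %| m)%N.
Proof.
have p0 := prime_gt0 p_prime.
have [t t0] : exists t, e ord0 t != 0.
  apply/existsP; apply: contraNT e0 => /existsPn H.
  by apply/eqP/rowP => t; rewrite mxE; apply/eqP/negPn.
exists (iter (t + p.-1 * j) (@ordS p) (Ordinal p0)), (e ord0 t).
rewrite Fp_dvd // t0; split=> //; rewrite psi1_spinal /spinal_index.
rewrite iter_ordS add0n modnDmr addnCA -mulSn prednK // mulnC addnC modnMDl modn_small ?valK //.
exact: leq_trans (ltn_ord t) (leq_pred _).
Qed.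

Definition spinal_rank2 := generated [set a; b].
Local Notation G0 := spinal_rank2.
Local Notation G1 := (derived G0).
Local Notation G2 := (derived G1).

Let G0S : is_subgroup G0. Proof. exact: generated_subgroup. Qed.
Let G0a : G0 a. Proof. by apply: sub_generated; left. Qed.
Let G0b : G0 b. Proof. by apply: sub_generated; right. Qed.
Let G0ak k : G0 (a ^+ k)%g. Proof. exact: (subgroupX _ G0S). Qed.
Let G1S : is_subgroup G1. Proof. exact: generated_subgroup. Qed.
Let G2S : is_subgroup G2. Proof. exact: generated_subgroup. Qed.
Let G0c x : G0 (c x). Proof. by apply: (subgroupJ G0S). Qed.

Let apow := powers_subgroup (rooted_expp p) (prime_gt0 p_prime).
Let bpow := powers_subgroup (spinal_expp j e) (prime_gt0 p_prime).

Let apow_commute (u v : tree_aut p) : (exists m, u = a ^+ m)%g -> (exists m, v = a ^+ m)%g ->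
  [~ u, v]%g = 1%g.
Proof. by move=> [m ->] [n ->]; apply/eqP/commgP/commuteX2. Qed.

Let powers_gen m : ~~ (p %| m)%N -> exists n, (a = (a ^+ m) ^+ n)%g.
Proof.
move=> pm; have : coprime m p by rewrite coprime_sym prime_coprime.
move=> /coprimeP -/(_ _)[]; first by rewrite lt0n; apply: contra pm => /eqP->.
move=> [u v] /= uv; exists u; rewrite -expgnA mulnC -[LHS]expg1.
have /(congr1 (fun n => (a ^+ n)%g)) : (u * m = 1 + v * p)%N by lia.
by rewrite expgnDr [(v * p)%N]mulnC expgnA (rooted_expp p) expg1n mulg1 => ->.
Qed.

Section Lifting.
Variables (x y : 'I_p) (m : nat).
Hypotheses (pm : ~~ (p %| m)%N) (xym : psi1 (c x) y = (a ^+ m)%g).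

(** A power of the conjugate [c x] lifts a to the coordinate y, and [c y] lifts b. Outside x and y
    both have powers of a as sections; at x they have powers of b, provided that [c y] is trivial
    there. All these sections commute, so they disappear in commutators, which gives [lift1]. *)
Let lift0 g := exists k, [/\ G0 k, stab1 k, psi1 k y = g,
  forall z, z != x -> z != y -> exists n, psi1 k z = (a ^+ n)%g
  & psi1 (c y) x = 1%g -> exists n, psi1 k x = (b ^+ n)%g].

Lemma lift_fractal : G0 `<=` lift0.
Proof.
apply: generated_min.
  apply/subgroupP; split.
    exists 1%g; split; rewrite ?psi1_1 //; first exact: (subgroup1 G0S).
      by move=> z _ _; exists 0%N; rewrite ?psi1_1.
    by exists 0%N; rewrite ?psi1_1.
  move=> g h [k [Gk kS <- kz kx]] [l [Gl lS <- lz lx]].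
  have [lV GlV] := (stab1V lS, subgroupV G0S Gl).
  exists (k / l)%g; split=> [|| |z zx zy|yx]; rewrite ?psi1M ?psi1V //.
  - exact: (subgroupM G0S).
  - exact: stab1M.
  - by have /subgroupP[_] := apow; apply; [exact: kz | exact: lz].
  - by have /subgroupP[_] := bpow; apply; [exact: kx | exact: lx].
move=> _ [->|->].
  have [n aE] := powers_gen pm.
  exists (c x ^+ n)%g; split=> [|| |z zx zy|yx]; rewrite ?psi1X //.
  - exact: (subgroupX _ G0S).
  - exact: stab1X.
  - by rewrite xym -aE.
  - by have [l ->] := psi1_spinal_at_neq zx; exists (l * n)%N; rewrite expgnA.
  - by exists n; rewrite psi1_spinal_at.
exists (c y); split=> // [|z zx zy|yx]; first exact: psi1_spinal_at.
  exact: psi1_spinal_at_neq.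
by exists 0%N; rewrite yx.
Qed.

Let lift1 g := exists k, [/\ G1 k, stab1 k, psi1 k y = g,
  forall z, z != x -> z != y -> psi1 k z = 1%g & psi1 (c y) x = 1%g -> psi1 k x = 1%g].

Lemma lift_derived : G1 `<=` lift1.
Proof.
apply: generated_min.
  apply/subgroupP; split.
    exists 1%g; split; rewrite ?psi1_1 //; first exact: (subgroup1 G1S).
    by move=> z; rewrite psi1_1.
  move=> g h [k [Gk kS <- kz kx]] [l [Gl lS <- lz lx]].
  have [lV GlV] := (stab1V lS, subgroupV G1S Gl).
  exists (k / l)%g; split=> [|| |z zx zy|yx]; rewrite ?psi1M ?psi1V //.
  - exact: (subgroupM G1S).
  - exact: stab1M.
  - by rewrite kz // lz // mulgV.
  - by rewrite kx // lx // mulgV.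
move=> _ [g [h [Gg Gh ->]]].
have [k [Gk kS <- kz kx]] := lift_fractal Gg; have [l [Gl lS <- lz lx]] := lift_fractal Gh.
exists [~ k, l]%g; split=> [|| |z zx zy|yx]; rewrite ?psi1R //.
- exact: derivedR.
- exact: stab1R.
- by apply: apow_commute; [exact: kz | exact: lz].
- by have [[n ->] [n' ->]] := (kx yx, lx yx); apply/eqP/commgP/commuteX2.
Qed.

End Lifting.

Let active : exists x y m, [/\ x != y, ~~ (p %| m)%N & psi1 (c x) y = (a ^+ m)%g].
Proof.
have [z [m [zE pm]]] := spinal_nontrivial_section.
exists o, z, m; split=> //; last by rewrite -zE spinal_at_pos.
apply: contra pm => /eqP oz; have := zE; rewrite -oz bo => bE.
have := bS z; rewrite bE rooted_exp => -[/eqP].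
by rewrite -[X in _ == X]/(iter 0 sh z) iter_ordS_eq mod0n.
Qed.

Let active_at y : exists x m, [/\ x != y, ~~ (p %| m)%N & psi1 (c x) y = (a ^+ m)%g].
Proof.
have [x [y' [m [xy pm xyE]]]] := active; have [k <-] := iter_ordS_onto y' y.
exists (iter k sh x), m; rewrite psi1_spinal_at_shift; split=> //; apply: contra xy.
by elim: (k) => //= l IH /eqP/(can_inj (@ordSK p))/eqP.
Qed.

(* If the section of c_y at x is trivial then the lift of the first entry of a    *)
(* commutator is supported at y alone; otherwise the lifts of the two entries can *)
(* be taken with supports {x, y} and {2y - x, y}.                                 *)
Lemma weakly_regular_branch y g : G2 g ->
  exists k, [/\ G2 k, stab1 k, psi1 k y = g & forall z, z != y -> psi1 k z = 1%g].
Proof.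
pose L g := exists k, [/\ G2 k, stab1 k, psi1 k y = g & forall z, z != y -> psi1 k z = 1%g].
apply: (@generated_min _ _ L).
  apply/subgroupP; split.
    exists 1%g; split; rewrite ?psi1_1 //; first exact: (subgroup1 G2S).
    by move=> z; rewrite psi1_1.
  move=> {}g h [k [Gk kS <- kz]] [l [Gl lS <- lz]].
  have [lV GlV] := (stab1V lS, subgroupV G2S Gl).
  exists (k / l)%g; split=> [|| |z zy]; rewrite ?psi1M ?psi1V //.
  - exact: (subgroupM G2S).
  - exact: stab1M.
  - by rewrite kz // lz // mulgV.
move=> _ [{}g [h [Gg Gh ->]]].
have [x [m [xy pm xym]]] := active_at y.
have [k [Gk kS ky kz kx]] := lift_derived pm xym Gg.
have conclude l : G1 l -> stab1 l -> psi1 l y = h ->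
    (forall z, z != y -> psi1 k z = 1%g \/ psi1 l z = 1%g) -> L [~ g, h]%g.
  move=> Gl lS ly lz; exists [~ k, l]%g; split; rewrite ?psi1R ?ky ?ly //.
  - exact: derivedR.
  - exact: stab1R.
  - move=> z zy; rewrite psi1R //.
    by have [->|->] := lz z zy; rewrite ?comm1g ?commg1.
have [yx1|yx1] := pselect (psi1 (c y) x = 1%g).
  have [l [Gl lS ly _ _]] := lift_derived pm xym Gh.
  apply: (conclude l) => // z zy; left.
  by have [->|zx] := eqVneq z x; [exact: kx | exact: kz].
have [n yxn] := psi1_spinal_at_neq xy.
have pn : ~~ (p %| n)%N.
  apply: contra_notN yx1 => /dvdnP[q nE].
  by rewrite yxn nE mulnC expgnA (rooted_expp p) expg1n.
(* As y = x + t, the letter [x'] is x + 2t, and it differs from x because p is odd. By shift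
   invariance the section of [c x'] at y is that of [c y] at x. *)
have [t ty] := iter_ordS_onto x y; pose x' := iter t sh y.
have tN : ~~ (p %| t)%N.
  apply: contra xy => pt; rewrite -ty -{1}[x]/(iter 0 sh x) iter_ordS_eq mod0n eq_sym.
  by rewrite (eqP pt).
have x'y : x' != y.
  by rewrite /x' -[X in _ != X]/(iter 0 sh y) iter_ordS_eq mod0n.
have x'x : x' != x.
  rewrite /x' -ty -iterD -[X in _ != X]/(iter 0 sh x) iter_ordS_eq mod0n.
  rewrite addnn -mul2n -/(dvdn p _) Euclid_dvdM // negb_or tN andbT.
  by rewrite dvdn_prime2 //; apply: contraTneq p_odd => ->.
have x'ym : psi1 (c x') y = (a ^+ n)%g by rewrite -yxn -ty /x' psi1_spinal_at_shift ty.
have [l [Gl lS ly lz _]] := lift_derived pn x'ym Gh.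
apply: (conclude l) => // z zy; have [zx|zx] := eqVneq z x; last by left; exact: kz.
by right; apply: lz => //; rewrite zx eq_sym.
Qed.


(** An explicit double commutator of [c x] and [c y] has section [[A, b], b / A] at y, for a
    nontrivial power A of a. If this were trivial, comparing sections once more would make b a power
    of a. *)
Lemma second_derived_nontrivial : exists2 z, G2 z & z <> 1%g.
Proof.
have [x [y [m [xy pm xym]]]] := active; set A := (a ^+ m)%g in xym.
have G1q : G1 (c y / c x)%g.
  have [k <-] := iter_ordS_onto x y; have [l <-] := iter_ordS_onto o x.
  have -> : (c (iter k sh (iter l sh o)) / c (iter l sh o) = [~ a ^+ k, (c (iter l sh o))^-1])%g.
    rewrite -iterD !spinal_atE addnC expgnDr conjgM; set d := (b ^ _)%g.
    by rewrite commgEl !conjgE invgK !mulgA.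
  by apply: derivedR => //; exact: (subgroupV G0S).
exists [~ [~ c x, c y], c y / c x]%g.
  by apply: derivedR => //; exact: derivedR.
move=> /(congr1 (fun g => psi1 g y)).
have cV := stab1V (cS x).
have E1 : psi1 [~ c x, c y]%g y = [~ A, b]%g.
  by rewrite (psi1R _ (cS x) (cS y)) xym psi1_spinal_at.
have E2 : psi1 (c y / c x)%g y = (b / A)%g.
  by rewrite (psi1M _ _ (cS y)) (psi1V _ (cS x)) xym psi1_spinal_at.
rewrite psi1_1 (psi1R _ (stab1R (cS x) (cS y)) (stab1M (cS y) cV)) E1 E2.
move=> /eqP/commgP; rewrite /commute => comm.
(* The commutation relation, rewritten in the conjugates of b by 1, A and AA only, which all fix the
   first level. *)
have {comm} : ((b ^ A)^-1 * (b * b) = b * (b ^ (A * A))^-1 * b ^ A)%g.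
  have := congr1 (fun g => (g * A)%g) comm.
  rewrite commgEl !conjgE !invgM !invgK !mulgA !mulgVK.
  by move=> ->; rewrite mulgK.
move=> comm.
(* At this coordinate the conjugate of b by AA has section b, whereas b and its conjugate by A have
   powers of a there. *)
pose u := iter (m + m) sh o.
have oN k : ~~ (p %| k)%N -> iter k sh o != o.
  by move=> pk; rewrite -[X in _ != X]/(iter 0 sh o) iter_ordS_eq mod0n.
have uo : u != o.
  apply: oN; rewrite addnn -mul2n Euclid_dvdM // negb_or pm andbT.
  by rewrite dvdn_prime2 //; apply: contraTneq p_odd => ->.
have [n1 bu] := bN uo.
have AAE : (A * A = a ^+ (m + m))%g by rewrite expgnDr.
have bAAS : stab1 (b ^ (A * A))%g by rewrite AAE; exact: stab1_conj_rooted.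
have bAS : stab1 (b ^ A)%g by exact: stab1_conj_rooted.
have bAAu : psi1 (b ^ (A * A))%g u = b by rewrite AAE psi1_conj_rooted.
have [n2 bAu] : exists n, psi1 (b ^ A)%g u = (a ^+ n)%g.
  by rewrite /u iterD psi1_conj_rooted //; apply: bN; exact: oN.
have [SA SAA] := (stab1V bAS, stab1V bAAS).
have := congr1 (fun g => psi1 g u) comm.
rewrite (psi1M _ _ SA) (psi1M _ _ (stab1M bS SAA)) !(psi1M _ _ bS).
rewrite (psi1V _ bAS) (psi1V _ bAAS). rewrite bu bAAu bAu => E.
have [n bE] : exists n, b = (a ^+ n)%g.
  have /subgroupP[_ D] := apow.
  have pw k : [set g | exists m, g = (a ^+ m)%g] (a ^+ k)%g by exists k.
  have -> : b = (a ^+ n2 / ((a ^+ n2)^-1 * (a ^+ n1 * a ^+ n1)) * a ^+ n1)%g.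
    by rewrite E !invgM !invgK !mulgA !mulgV !mul1g ?mulgK ?mulgVK ?mulVg ?mulg1.
  apply: (subgroupM apow) => //; apply: D => //.
  by apply: (subgroupM apow); [apply: (subgroupV apow) | apply: (subgroupM apow)].
have [z [q [zE pq]]] := spinal_nontrivial_section.
have := bS z; rewrite bE rooted_exp => -[/eqP].
rewrite -[X in _ == X]/(iter 0 sh z) iter_ordS_eq mod0n => /dvdnP[k nE].
have b1 : b = 1%g by rewrite bE nE mulnC expgnA rooted_expp expg1n.
apply: (negP pq).
have := congr1 (fun g : tree_aut p => g [:: z]) zE; rewrite b1 psi1_1 rooted_exp => -[/esym/eqP].
by rewrite -[X in _ == X]/(iter 0 sh z) iter_ordS_eq mod0n.
Qed.


Lemma second_derived_at_word w g : G2 g -> exists k, [/\ G2 k,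
  forall v, k (w ++ v) = w ++ g v & forall u, ~~ prefix w u -> k u = u].
Proof.
move=> Gg; elim: w => [|y w [k [Gk kE kN]]].
  by exists g; split=> // u; rewrite prefix0s.
have [l [Gl lS lE lN]] := weakly_regular_branch y Gk.
exists l; split=> // [v|[|z u]]; first by rewrite cat_cons stab1_cons // lE kE.
  by rewrite tree_aut_nil.
rewrite prefix_cons negb_and stab1_cons // => /orP[zy|wu].
  by rewrite lN // eq_sym.
have [->|zy] := eqVneq z y; first by rewrite lE kN.
by rewrite lN.
Qed.

(** Take z moving a word w, and let z' act as z below w and trivially elsewhere. As z moves the
    subtree at w off itself, commuting with z' would force z to fix w. *)
Lemma second_derived_noncommuting : exists z z', [/\ G2 z, G2 z' & (z * z' <> z' * z)%g].
Proof.
have [z Gz z1] := second_derived_nontrivial.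
have [w zw] : exists w, z w <> w.
  by apply/existsNP => H; apply: z1; exact: tree_aut_eq.
have [z' [Gz' z'E z'N]] := second_derived_at_word w Gz.
exists z, z'; split=> // comm; have := zw; apply.
have zwv v : z' (z (w ++ v)) = z (w ++ v).
  apply: z'N; rewrite prefixE tree_take; exact/eqP.
have H v : z (w ++ v) = z (w ++ z v).
  have := congr1 (fun g : tree_aut p => g (w ++ v)) comm.
  by rewrite -[LHS]/(z' (z (w ++ v))) -[RHS]/(z (z' (w ++ v))) zwv z'E.
have /(congr1 (z^-1)%g) := H w; rewrite !tree_invK => /(congr1 (drop (size w))).
by rewrite !drop_size_cat.
Qed.

(** Induction on N: the earlier pairs are moved into the subtree at one letter and a new
    noncommuting pair is placed in the subtree at another. Elements supported on different subtrees
    commute. *)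
Lemma commuting_pairs N : exists x y : nat -> tree_aut p,
  [/\ forall i, (i < N)%N -> G2 (x i) /\ G2 (y i),
      forall i, (i < N)%N -> (x i * y i <> y i * x i)%g
    & forall i k, (i < N)%N -> (k < N)%N -> i != k -> (x i * y k = y k * x i)%g].
Proof.
have p1 := prime_gt1 p_prime.
pose l0 : 'I_p := Ordinal (ltnW p1); pose l1 : 'I_p := Ordinal p1.
have [z [z' [Gz Gz' zz']]] := second_derived_noncommuting.
elim: N => [|N [x [y [Gxy xyN xyC]]]]; first by exists (fun=> 1%g), (fun=> 1%g).
have lift l g : {k | G2 g -> [/\ G2 k, stab1 k, psi1 k l = g & forall z, z != l -> psi1 k z = 1%g]}.
  by apply: cid; have [/(weakly_regular_branch l)[k kP]|nGg] := pselect (G2 g);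
    [exists k | exists 1%g].
pose L l g := sval (lift l g).
have LP l g : G2 g -> [/\ G2 (L l g), stab1 (L l g), psi1 (L l g) l = g
    & forall z, z != l -> psi1 (L l g) z = 1%g].
  exact: (svalP (lift l g)).
have LC l g h : G2 g -> G2 h -> (g * h = h * g)%g -> (L l g * L l h = L l h * L l g)%g.
  move=> /(LP l)[_ gS gl gN] /(LP l)[_ hS hl hN] gh.
  apply: stab1_eq; [exact: stab1M | exact: stab1M | move=> t].
  rewrite (psi1M _ _ gS) (psi1M _ _ hS); have [->|tl] := eqVneq t l; first by rewrite gl hl.
  by rewrite gN // hN.
have LD l l' g h : l != l' -> G2 g -> G2 h -> (L l g * L l' h = L l' h * L l g)%g.
  move=> ll' /(LP l)[_ gS gl gN] /(LP l')[_ hS hl hN].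
  apply: stab1_eq; [exact: stab1M | exact: stab1M | move=> t].
  rewrite (psi1M _ _ gS) (psi1M _ _ hS); have [->|tl] := eqVneq t l.
    by rewrite (hN l) // mulg1 mul1g.
  by rewrite gN // mulg1 mul1g.
have LN l g h : G2 g -> G2 h -> (g * h <> h * g)%g -> (L l g * L l h <> L l h * L l g)%g.
  move=> /(LP l)[_ gS gl _] /(LP l)[_ hS hl _] gh /(congr1 (fun k => psi1 k l)).
  by rewrite (psi1M _ _ gS) (psi1M _ _ hS) gl hl.
have l01 : l0 != l1 by [].
have l10 : l1 != l0 by [].
exists (fun i => if i is i'.+1 then L l0 (x i') else L l1 z).
exists (fun i => if i is i'.+1 then L l0 (y i') else L l1 z').
split=> [[_|i /Gxy[Gx Gy]]|[_|i iN]|[|i] [|k] //= iN kN ik].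
- by have [[? _ _ _] [? _ _ _]] := (LP l1 _ Gz, LP l1 _ Gz').
- by have [[? _ _ _] [? _ _ _]] := (LP l0 _ Gx, LP l0 _ Gy).
- exact: LN.
- by have [Gx Gy] := Gxy _ iN; apply: LN => //; exact: xyN.
- by have [_ Gy] := Gxy _ kN; exact: LD.
- by have [Gx _] := Gxy _ iN; exact: LD.
- by have [[Gx _] [_ Gy]] := (Gxy _ iN, Gxy _ kN); apply: LC => //; exact: xyC.
Qed.

Lemma second_derived_sub : G2 `<=` G0.
Proof. by apply: (subset_trans (derived_sub G1S)); exact: derived_sub. Qed.

End WeaklyBranch.

(** * Torsion *)

Section Torsion.
Variables (p j : nat) (e : 'rV['F_p]_p.-1).
Hypotheses (p_prime : prime p) (sum_e : \sum_t e ord0 t = 0).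
Local Notation a := (rooted p).
Local Notation b := (spinal j e).
Local Notation sh := (@ordS p).
Local Notation c := (@spinal_at p j e p_prime).
Local Notation o := (@spinal_pos p j p_prime).

(** The indices belong to an expression of g, not to g itself: the number of powers of b in it and
    the total exponent of a. *)
Inductive syllables : nat -> nat -> tree_aut p -> Prop :=
| SyllA k : syllables 0 k (a ^+ k)%g
| SyllB l : syllables 1 0 (b ^+ l)%g
| SyllM m n k l g h : syllables m k g -> syllables n l h ->
    syllables (m + n) (k + l) (g * h)%g.

Definition p_torsion (g : tree_aut p) := exists m, (g ^+ (p ^ m))%g = 1%g.

(** The powers of b are distributed among the sections. Each of them contributes a multiple of the
    sum of the entries of e to the exponents of a, which is 0 modulo p by [sum_e]. If one section
    receives all the powers of b, then h is a power of a single conjugate of b; this is the case in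
    which the induction on n cannot descend. *)
Let decomposed n k g := exists h (N K : 'I_p -> nat),
  [/\ g = (h * a ^+ k)%g, stab1 h, forall x, syllables (N x) (K x) (psi1 h x),
      (\sum_x N x)%N = n /\ (p %| \sum_x K x)%N
    & forall x, N x = n -> exists l, h = (c x ^+ l)%g].

Let syllables_decomposed n k g : syllables n k g -> decomposed n k g.
Proof.
elim=> {n k g} [k|l|m n k l g h _ IHg _ IHh].
- exists 1%g, (fun=> 0%N), (fun=> 0%N); split=> //.
  + by rewrite mul1g.
  + by move=> x; rewrite psi1_1; exact: (SyllA 0).
  + by rewrite !big1 ?dvdn0.
  + by move=> x _; exists 0%N.
- exists (b ^+ l)%g, (fun x => (x == o) : nat).
  exists (fun x => if spinal_index j x is Some t then (e ord0 t * l)%N else 0%N); split.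
  + by rewrite mulg1.
  + by apply: stab1X; exact: spinal_stab1.
  + move=> x; rewrite psi1X; last exact: spinal_stab1.
    rewrite psi1_spinal -spinal_index_eqNone; case: spinal_index => [t|] /=; last exact: SyllB.
    by rewrite -expgnA; exact: SyllA.
  + split; first by rewrite (bigD1 o) //= eqxx big1 ?addn0 // => x /negPf ->.
    have := @sum_spinal_index p p_prime nat j (fun u => if u is Some t then (e ord0 t * l)%N else 0%N).
    rewrite add0r => E; suff : (p %| \sum_t e ord0 t * l)%N by rewrite -E.
    rewrite (dvdn_pcharf (pchar_Fp p_prime)) natr_sum.
    under eq_bigr do rewrite natrM natr_Zp.
    by rewrite -mulr_suml sum_e mul0r.
  + move=> x; have [-> _|//] := eqVneq x o; exists l.
    by rewrite spinal_at_pos.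
- have [g' [N [K [-> gS gNK [NE KE] gc]]]] := IHg.
  have [h' [N' [K' [-> hS hNK [N'E K'E] hc]]]] := IHh.
  pose u x := iter k sh x.
  have u_inj : injective u.
    by rewrite /u; elim: (k) => // i IH x y /(can_inj (@ordSK p))/IH.
  (* Moving the power of a past [h'] replaces it by its conjugate by the inverse of that power; -k
     is written as (p - 1)k. *)
  pose h2 := (h' ^ (a ^+ (p.-1 * k)))%g.
  have ak1 : (a ^+ (p.-1 * k) * a ^+ k = 1)%g.
    by rewrite -expgnDr addnC -mulSn prednK ?prime_gt0 // expgnA rooted_expp expg1n.
  have ak : ((a ^+ (p.-1 * k))^-1 = a ^+ k)%g.
    by apply: (mulgI (a ^+ (p.-1 * k))%g); rewrite mulgV ak1.
  have uK x : iter (p.-1 * k) sh (u x) = x.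
    apply/eqP; rewrite /u -iterD -[X in _ == X]/(iter 0 sh x) iter_ordS_eq.
    by rewrite addnC -mulSn prednK ?prime_gt0 // modnMr mod0n.
  have h2E x : psi1 h2 x = psi1 h' (u x) by rewrite -[in LHS](uK x) psi1_conj_rooted.
  have h2S : stab1 h2 by exact: stab1_conj_rooted.
  have Nle x : (N x <= m)%N by rewrite -NE (bigD1 x) //= leq_addr.
  have N'le x : (N' x <= n)%N by rewrite -N'E (bigD1 x) //= leq_addr.
  exists (g' * h2)%g, (fun x => N x + N' (u x))%N, (fun x => K x + K' (u x))%N; split.
  + rewrite expgnDr !mulgA; congr (_ * _)%g.
    by rewrite ak -[RHS]mulgA ak1 mulg1.
  + exact: stab1M.
  + by move=> x; rewrite (psi1M _ _ gS) h2E; exact: SyllM.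
  + have uE (M : 'I_p -> nat) : (\sum_x M (u x) = \sum_x M x)%N by rewrite [RHS](reindex_inj u_inj).
    by rewrite !big_split /= !uE NE N'E; split=> //; exact: dvdn_add.
  + move=> x NN; have [Nm N'n] : N x = m /\ N' (u x) = n.
      by have := Nle x; have := N'le (u x); lia.
    have [i ->] := gc _ Nm; have [i' h'E] := hc _ N'n.
    exists (i + i')%N; rewrite expgnDr; congr (_ * _)%g.
    by rewrite /h2 h'E conjXg -spinal_at_conj uK.
Qed.


Let stab1_torsion g : stab1 g -> (forall x, p_torsion (psi1 g x)) -> p_torsion g.
Proof.
move=> gS gT; pose f x := sval (cid (gT x)).
exists (\max_x f x)%N; apply: stab1_eq => // [|x]; first exact: stab1X.
rewrite psi1X // psi1_1 -(subnK (leq_bigmax x)) expnD mulnC expgnA.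
by rewrite (svalP (cid (gT x))) expg1n.
Qed.

(* Induction on n. If g moves the first level, the sections of g^p are products of  *)
(* all the sections of g, along a cycle; by [sum_e] their total exponent of a is 0  *)
(* mod p, so they fix the first level, where the sections use fewer powers of b.    *)
Lemma syllables_torsion n k g : syllables n k g -> p_torsion g.
Proof.
elim/ltn_ind: n k g => n IH k g.
have rooted_dvd q : (p %| q)%N -> (a ^+ q)%g = 1%g.
  by move=> /dvdnP[r ->]; rewrite mulnC expgnA rooted_expp expg1n.
have base q g' : (p %| q)%N -> syllables n q g' -> p_torsion g'.
  move=> pq /syllables_decomposed[h [N [K [-> hS hNK [NE _] hc]]]].
  rewrite rooted_dvd // mulg1; have [[x Nx]|nN] := pselect (exists x, N x = n).
    have [l ->] := hc _ Nx; exists 1%N.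
    rewrite expn1 -expgnA mulnC expgnA.
    have [r <-] := iter_ordS_onto o x.
    by rewrite spinal_atE -conjXg spinal_expp conj1g expg1n.
  apply: stab1_torsion => // x; apply: (IH (N x)); last exact: hNK.
  have : (N x <= n)%N by rewrite -NE (bigD1 x) //= leq_addr.
  by rewrite leq_eqVlt => /orP[/eqP Nx|//]; case: nN; exists x.
move=> gn; have [pk|pk] := boolP (p %| k)%N; first exact: base gn.
have [h [N [K [gE hS hNK [NE KE] _]]]] := syllables_decomposed gn.
suff [m gm] : p_torsion (g ^+ p)%g by exists m.+1; rewrite expnS expgnA.
have ghead x w : g (x :: w) = iter k sh x :: psi1 h x w.
  by rewrite gE -[LHS]/((a ^+ k)%g (h (x :: w))) stab1_cons // rooted_exp.
pose P q x := (\prod_(i < q) psi1 h (iter (k * i) sh x))%g.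
have gX q x w : (g ^+ q)%g (x :: w) = iter (k * q) sh x :: P q x w.
  elim: q => [|q IHq]; first by rewrite muln0 /P big_ord0.
  rewrite expgSr -[LHS]/(g ((g ^+ q)%g (x :: w))) IHq ghead -iterD mulnS; congr cons.
  by rewrite /P big_ord_recr.
have gpS : stab1 (g ^+ p)%g.
  by move=> x; rewrite gX tree_aut_nil; congr cons; apply/eqP;
     rewrite -[X in _ == X]/(iter 0 sh x) iter_ordS_eq modnMl mod0n.
have psigp x : psi1 (g ^+ p)%g x = P p x by apply: tree_aut_eq => w /=; rewrite gX.
apply: stab1_torsion => // x; rewrite psigp.
have syllP q : syllables (\sum_(i < q) N (iter (k * i) sh x))
    (\sum_(i < q) K (iter (k * i) sh x)) (P q x).
  elim: q => [|q IHq]; first by rewrite /P !big_ord0; exact: (SyllA 0).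
  by rewrite /P !big_ord_recr /=; apply: SyllM => //; exact: hNK.
have := syllP p; rewrite (@sum_iter_ordS p p_prime nat N) // (@sum_iter_ordS p p_prime nat K) //.
rewrite -[X in syllables X]/(\sum_x N x)%N NE; exact: base.
Qed.

Lemma spinal_rank2_torsion g : generated [set a; b] g -> p_torsion g.
Proof.
pose S g := exists n k, syllables n k g.
suff : generated [set a; b] `<=` S by move=> H /H[n [k]]; exact: syllables_torsion.
apply: generated_min => [|_ [->|->]]; last 2 first.
- by exists 0%N, 1%N; exact: (SyllA 1).
- by exists 1%N, 0%N; exact: (SyllB 1).
apply/subgroupP; split; first by exists 0%N, 0%N; exact: (SyllA 0).
move=> {}g h [n [k gS]] [m [l hS]].
have [m' [l' hV]] : S (h^-1)%g.
  have inv (u : tree_aut p) q : (u ^+ p = 1 -> (u ^+ q)^-1 = u ^+ (p.-1 * q))%g.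
    move=> up; apply: (mulgI (u ^+ q)%g).
    by rewrite mulgV -expgnDr -mulSn prednK ?prime_gt0 // expgnA up expg1n.
  elim: hS => {g n k gS h m l} [k|l|m n k l g h _ [n' [k' gV]] _ [m' [l' hV]]].
  - by rewrite inv ?rooted_expp //; exists 0%N, (p.-1 * k)%N; exact: SyllA.
  - by rewrite inv ?spinal_expp //; exists 1%N, 0%N; exact: SyllB.
  - by rewrite invgM; exists (m' + n')%N, (l' + k')%N; exact: SyllM.
by exists (n + m')%N, (k + l')%N; exact: SyllM.
Qed.

End Torsion.

(** * Actions of torsion p-groups *)

Section FixedRow.
Import fingroup cyclic pgroup mxrepresentation mxabelem.

(** The set M lies in the finite group of invertible matrices over the field with p elements, where
    Cauchy's theorem makes it a p-group. A p-group fixes a nonzero vector in characteristic p. *)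
Lemma fixed_row (p n : nat) (M : set 'M['F_p]_n.+1) : prime p -> M 1 ->
  (forall A B, M A -> M B -> M (A * B)) ->
  (forall A, M A -> exists m, A ^+ (p ^ m) = 1) ->
  exists2 l : 'rV['F_p]_n.+1, l != 0 & forall A, M A -> l *m A = l.
Proof.
move=> p_pr M1 MM MT.
pose P := finset (fun x : {'GL_n.+1['F_p]} => `[< M (GLval x) >]).
have PE x : (x \in P) = `[< M (GLval x) >] by rewrite finset.inE.
have gP : group_set P.
  apply/group_setP; split; first by rewrite PE; apply/asboolP.
  by move=> x y; rewrite !PE => /asboolP Mx /asboolP My; apply/asboolP; exact: MM.
pose G := Group gP.
have pP : (p.-group G)%g.
  apply/pgroupP => q q_pr /(Cauchy q_pr)[x]; rewrite PE => /asboolP/MT[m xm] xq.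
  have xm1 : (x ^+ (p ^ m) = 1)%g.
    apply: val_inj; rewrite -[RHS]xm; elim: (p ^ m)%N => // k IH.
    by rewrite expgS exprS -IH.
  have : (q %| p ^ m)%N by rewrite -xq order_dvdn xm1.
  by rewrite Euclid_dvdX // dvdn_prime2 // => /andP[/eqP-> _]; rewrite inE.
have rP : mx_repr G (@GLval n.+1 'F_p) by split.
have := rfix_pgroup_pchar (pchar_Fp p_pr) (MxRepresentation rP) (ltn0Sn n) pP (subxx _).
move=> /rowV0Pn[l /rfix_mxP lP l0]; exists l => // A MA.
have uA : A \is a GRing.unit.
  have [m Am] := MT _ MA; have : (0 < p ^ m)%N by rewrite expn_gt0 prime_gt0.
  by move=> /(@unitrX_pos _ A) <-; rewrite Am unitr1.
pose x : {'GL_n.+1['F_p]} := Sub A uA.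
by apply: (lP x); rewrite PE; apply/asboolP.
Qed.

End FixedRow.

(** A fixed row is a nonzero invariant linear functional. Its kernel is invariant and proper, hence
    0, and it contains all differences between a vector and its translates. *)
Lemma irreducible_ptorsion_trivial (p : nat) (V : lmodType 'F_p) (gT : groupType)
    (H : set gT) (rho : gT -> {linear V -> V}) : prime p ->
  is_subgroup H -> is_repr H rho -> repr_irreducible H rho -> finite_dimensional 'F_p V ->
  (forall h, H h -> exists m, (h ^+ (p ^ m))%g = 1%g) ->
  forall h v, H h -> rho h v = v.
Proof.
move=> p_pr HS [r1 rM] [[v0 v0N] irr] /finite_dimensional_coord[n [crd [crdL [icrd crdK icrdK]]]] HT.
have icrdL : linear icrd.
  by move=> c u v; apply: (can_inj crdK); rewrite icrdK crdL !icrdK.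
have AE h : exists A : 'M['F_p]_n, forall v, crd (rho h v) = A *m crd v.
  have fL : linear (fun x => crd (rho h (icrd x))).
    by move=> c u v; rewrite icrdL linearP crdL.
  by have [A AE] := matrix_of_linear fL; exists A => v; rewrite -AE crdK.
case: n crd crdL icrd crdK icrdK icrdL AE => [|n] crd crdL icrd crdK icrdK icrdL AE.
  by case/eqP: v0N; apply: (can_inj crdK); rewrite [LHS]flatmx0 [RHS]flatmx0.
pose M := [set A : 'M['F_p]_n.+1 | exists2 h, H h & forall v, crd (rho h v) = A *m crd v].
have Meq (A B : 'M['F_p]_n.+1) : (forall v, A *m crd v = B *m crd v) -> A = B.
  move=> AB; apply/trmx_inj/row_matrixP => i.
  apply: trmx_inj; rewrite -!tr_col !trmxK !colE.
  by have := AB (icrd (delta_mx i ord0)); rewrite icrdK.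
have [||A [h Hh hA]|l l0 lM] := @fixed_row p n M p_pr.
- by exists 1%g; [exact: subgroup1 | move=> v; rewrite r1 mul1mx].
- move=> A B [g Hg gA] [h Hh hB]; exists (g * h)%g; first exact: (subgroupM HS).
  by move=> v; rewrite rM // gA hB mulmxA.
- have [m hm] := HT h Hh; exists m; apply: Meq => v.
  rewrite mul1mx -[RHS]/(crd v) -{2}(r1 v) -hm; elim: (p ^ m)%N v => [|k IH] v.
    by rewrite mul1mx r1.
  by rewrite expgS rM //; [rewrite hA -IH exprS mulmxA | exact: (subgroupX _ HS)].
pose f v := (l *m crd v) ord0 ord0.
have fL c u v : f (c *: u + v) = c * f u + f v.
  by rewrite /f crdL mulmxDr -scalemxAr !mxE.
have f0 : f 0 = 0.
  by have := fL (-1) 0 0; rewrite scaler0 addr0 mulN1r addNr.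
have fH h v : H h -> f (rho h v) = f v.
  move=> Hh; have [A hA] := AE h.
  by rewrite /f hA mulmxA lM //; exists h.
pose W := [set v | f v = 0].
have WS : submod_closed [in W].
  by apply/submodP; split=> // c u v fu fv; rewrite /W /= fL fu fv mulr0 addr0.
have WH h v : H h -> W v -> W (rho h v) by move=> Hh; rewrite /W /= fH.
have [W0|WT] := irr W WS WH; last first.
  case/eqP: l0; apply/rowP => i.
  have : W (icrd (delta_mx i ord0)) by rewrite WT.
  by rewrite /W /= /f icrdK -colE !mxE.
move=> h v Hh; have : W (rho h v - v).
  by rewrite /W /= addrC -scaleN1r fL fH // mulN1r addNr.
by rewrite W0 /= => /eqP; rewrite subr_eq0 => /eqP.
Qed.

(* Pairing with the y_i shows that the x_i are linearly independent. *)
Lemma commuting_pairs_bound (L : fieldType) n N (x y : nat -> 'M[L]_n) :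
  (forall i k, (i < N)%N -> (k < N)%N -> i != k -> x i *m y k = y k *m x i) ->
  (forall i, (i < N)%N -> x i *m y i <> y i *m x i) -> (N <= n * n)%N.
Proof.
move=> xyC xyN; rewrite leqNgt; apply/negP => nN.
pose X := \matrix_(i < N) mxvec (x i).
have : kermx X != 0.
  rewrite kermx_eq0 -row_leq_rank -ltnNge; exact: leq_ltn_trans (rank_leq_col X) nN.
move=> /rowV0Pn[u /sub_kermxP uX u0].
have sum0 : \sum_(i < N) u ord0 i *: x i = 0.
  apply: (can_inj mxvecK); rewrite [RHS]linear0 -[RHS]uX mulmx_sum_row [LHS]linear_sum /=.
  by apply: eq_bigr => i _; rewrite linearZ rowK.
case/eqP: u0; apply/rowP => k; rewrite mxE.
have : \sum_(i < N) u ord0 i *: (x i *m y k - y k *m x i) = 0.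
  under eq_bigr do rewrite scalerBr scalemxAl scalemxAr.
  by rewrite sumrB -mulmx_suml -mulmx_sumr sum0 mul0mx mulmx0 subr0.
rewrite (bigD1 k) //= big1 ?addr0 => [/eqP|i ik]; last by rewrite xyC ?subrr ?scaler0.
by rewrite scaler_eq0 subr_eq0 => /orP[/eqP->//|/eqP/xyN]; case.
Qed.

(** * The tree enveloping algebra *)

Section FreeModuleMaps.
Variables (R : comNzRingType) (K : choiceType).

Lemma freegU_scale (c : R) (k : K) : << c *g k >> = c *: << k >> :> {freeg K / R}.
Proof. by apply/eqP/freeg_eqP => x; rewrite coeffZ !coeffU mul1r. Qed.

Lemma freeg_linear_eq (M : lmodType R) (f g : {linear {freeg K / R} -> M}) :
  (forall k, f << k >> = g << k >>) -> f =1 g.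
Proof.
move=> fg D; rewrite -(freeg_sumE D) !linear_sum; apply: eq_bigr => k _.
by rewrite freegU_scale !linearZ /= fg.
Qed.

End FreeModuleMaps.

Section GroupAlgebra.
Variable p : nat.
Local Notation FA := {freeg (tree_aut p) / 'F_p}.
Local Notation B := (boundary_space p).
Implicit Types (x y z : FA) (G : set (tree_aut p)).

Lemma group_algebra_submod G : submod_closed [in group_algebra G].
Proof.
apply/submodP; split=> [g|c x y Gx Gy g] /=; first by rewrite dom0.
rewrite mem_dom coeffD coeffZ => cg.
have [gx|gx] := boolP (g \in dom x); first exact: Gx.
apply: Gy; rewrite /= mem_dom; apply: contra cg => /eqP ->.
by rewrite coeff_outdom // mulr0 addr0.
Qed.

Lemma group_algebraU G g : G g -> group_algebra G << g >>.
Proof. by move=> Gg h; rewrite /= domU1 inE => /eqP->. Qed.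

Lemma group_algebra_ind G (P : set FA) : submod_closed [in P] ->
  (forall g, G g -> P << g >>) -> forall x, group_algebra G x -> P x.
Proof.
move=> PS PU x Gx; rewrite -(freeg_sumE x) big_seq; apply: submod_sum => // g gx.
by rewrite freegU_scale; apply: submod_scale => //; apply: PU; exact: Gx.
Qed.

Lemma augmentationU g : augmentation (<< g >> : FA) = 1.
Proof. by rewrite /augmentation liftU scale1r. Qed.

Lemma augmentation_linear : linear (@augmentation p : FA -> ('F_p)^o).
Proof. exact: linearP. Qed.

Lemma env_map_is_linear : linear (@env_map p).
Proof. exact: linearP. Qed.

Lemma env_aug_submod G : submod_closed [in @env_aug p G].
Proof.
have /submodP[G0 GL] := group_algebra_submod G.
apply/submodP; split.
  exists 0; last exact: (linear0 (linear_map env_map_is_linear)).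
  by split=> //; exact: (linear0 (linear_map augmentation_linear)).
move=> c _ _ [x [Gx x0] <-] [y [Gy y0] <-]; exists (c *: x + y).
  split; first exact: GL.
  by rewrite /= augmentation_linear [augmentation x]x0 [augmentation y]y0 scaler0 addr0.
exact: env_map_is_linear.
Qed.

Definition word_combination x f : word_function p := fglift (fun g => word_act g f : word_function p) x.

Lemma word_combinationU g f : word_combination << g >> f = word_act g f.
Proof. by rewrite /word_combination liftU scale1r. Qed.

(** A function on the vertices of level n, viewed as a linear functional on the boundary space. It
    lets the action on vertex functions be read off endomorphisms of that space. *)
Let evalr (f : word_function p) (n : nat) : {linear B -> ('F_p)^o} :=
  fglift (fun xi : boundary p => f (xi n) : ('F_p)^o).

Lemma evalrU f n xi : evalr f n << xi >> = f (xi n).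
Proof. by rewrite /evalr /= liftU scale1r. Qed.

Lemma word_ray (w : seq 'I_p) : (0 < p)%N -> exists xi : boundary p, xi (size w) = w.
Proof.
move=> p0; have [xi xiE] := ray_of_word (nth (Ordinal p0) w).
by exists xi; rewrite xiE mkseq_nth.
Qed.

Lemma word_combination_linear f : linear (word_combination^~ f).
Proof. exact: linearP. Qed.

Lemma word_combinationE x f (xi : boundary p) n :
  word_combination x f (xi n) = evalr f n (env_map x << xi >>).
Proof.
have L : linear ((fun x => word_combination x f (xi n)) : FA -> ('F_p)^o).
  by move=> c y z; rewrite word_combination_linear.
have R : linear ((fun x => evalr f n (env_map x << xi >>)) : FA -> ('F_p)^o).
  by move=> c y z; rewrite env_map_is_linear; exact: linearP.
have := @freeg_linear_eq _ _ _ (linear_map L) (linear_map R) _ x.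
apply=> g; rewrite /linear_map /= /linear_map_of.
by rewrite word_combinationU env_mapU tree_opU evalrU.
Qed.

Lemma word_combination_env x y f : (0 < p)%N -> env_map x = env_map y ->
  word_combination x f = word_combination y f.
Proof.
move=> p0 xy; apply: funext => w; have [xi <-] := word_ray w p0.
by rewrite !word_combinationE xy.
Qed.

(** Endomorphisms act on the right and vertex functions carry a left action, so the order of
    composition is reversed. *)
Lemma word_combinationM x y z f : (0 < p)%N -> env_map z = env_map y \o env_map x ->
  word_combination z f = word_combination x (word_combination y f).
Proof.
move=> p0 zE; apply: funext => w; have [xi <-] := word_ray w p0.
rewrite !word_combinationE zE /=.
have L : linear (evalr f (size w) \o env_map y : B -> ('F_p)^o).
  by move=> c u v; rewrite /= env_map_linear linearP.
apply: (@freeg_linear_eq _ _ _ (linear_map L) (evalr (word_combination y f) (size w))) => eta.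
by rewrite evalrU word_combinationE.
Qed.

End GroupAlgebra.

(** * Graded augmentation ideals *)

Section Graded.
Variables (p n : nat) (G : set (tree_aut p)) (Mx : {freeg (tree_aut p) / 'F_p} -> 'M['F_p]_n.+1).
Variable I : nat -> set (boundary_space p -> boundary_space p).
Local Notation FA := {freeg (tree_aut p) / 'F_p}.
Local Notation B := (boundary_space p).
Local Notation FG := (group_algebra G).
Local Notation MX := 'M[{poly 'F_p}]_n.+1.
Hypotheses (subG : is_subgroup G) (MxL : linear Mx).
Hypothesis Mx_env : forall x y, FG x -> FG y -> env_map x = env_map y -> Mx x = Mx y.
Hypothesis Mx_comp : forall x y z, FG x -> FG y -> FG z ->
  env_map z = env_map y \o env_map x -> Mx z = Mx x * Mx y.
Hypothesis gradI : is_grading (env_aug G) I.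

(** The matrix of an element of the enveloping algebra, computed from any preimage in the group
    algebra; by [Mx_env] the choice does not matter. *)
Let R (A : B -> B) := Mx (xget 0 [set x | FG x /\ env_map x = A]).

Let RE x : FG x -> R (env_map x) = Mx x.
Proof.
move=> Gx; have : [set y | FG y /\ env_map y = env_map x] (xget 0 [set y | FG y /\ env_map y = env_map x]).
  by apply: xgetPex; exists x.
by move=> [Gy yx]; exact: Mx_env.
Qed.

Let FG_lin c x y : FG x -> FG y -> FG (c *: x + y).
Proof. by move=> Gx Gy; have /submodP[_] := group_algebra_submod G; apply. Qed.

Let FG0 : FG 0. Proof. by have /submodP[] := group_algebra_submod G. Qed.

Let env_map0 : env_map (0 : FA) = 0.
Proof. exact: (linear0 (linear_map (@env_map_is_linear p))). Qed.

Let aug_in A : env_aug G A -> exists2 x, FG x & A = env_map x.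
Proof. by move=> [x [Gx _] <-]; exists x. Qed.

Let R_lin c A D : env_aug G A -> env_aug G D -> R (c *: A + D) = c *: R A + R D.
Proof.
move=> /aug_in[x Gx ->] /aug_in[y Gy ->].
by rewrite -env_map_is_linear !RE // ?MxL //; exact: FG_lin.
Qed.

Let R0 : R 0 = 0.
Proof. by rewrite -env_map0 RE //; exact: (linear0 (linear_map MxL)). Qed.

Let I_submod i : (0 < i)%N -> submod_closed [in I i].
Proof. by case: gradI => + _ _ _ i0 => /(_ i i0)[]. Qed.

Let I_aug i A : (0 < i)%N -> I i A -> env_aug G A.
Proof. by case: gradI => + _ _ _ i0 => /(_ i i0)[_]; apply. Qed.

Let t i (A : B -> B) : MX := 'X^i *: map_mx polyC (R A).

Let t0 i : t i 0 = 0. Proof. by rewrite /t R0 map_mx0 scaler0. Qed.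

(* P records the homogeneous components of A, the one of degree i being put in   *)
(* degree i of the polynomial variable.                                          *)
Let graded_image (A : B -> B) (P : MX) := exists m (c : nat -> B -> B),
  [/\ forall i, (0 < i)%N -> I i (c i), forall i, (m <= i)%N -> c i = 0,
      A = \sum_(1 <= i < m) c i & P = \sum_(1 <= i < m) t i (c i)].

Let sum_ext (W : nmodType) (f : nat -> W) m k : (forall i, (m <= i)%N -> f i = 0) -> (m <= k)%N ->
  \sum_(1 <= i < k) f i = \sum_(1 <= i < m) f i.
Proof.
case: m => [|m] f0 mk; first by rewrite [RHS]big_geq // big1.
rewrite (big_cat_nat _ (n := m.+1)) //= [X in _ + X]big_nat_cond [X in _ + X]big1 ?addr0 //.
by move=> i /andP[/andP[mi _] _]; exact: f0.
Qed.

Let graded_image_ext m k (c : nat -> B -> B) : (forall i, (m <= i)%N -> c i = 0) -> (m <= k)%N ->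
  \sum_(1 <= i < k) c i = \sum_(1 <= i < m) c i /\
  \sum_(1 <= i < k) t i (c i) = \sum_(1 <= i < m) t i (c i).
Proof. by move=> c0 mk; split; apply: sum_ext => // i mi; rewrite c0 ?t0. Qed.

Let graded_image_uniq A P Q : graded_image A P -> graded_image A Q -> P = Q.
Proof.
move=> [m [c [cI c0 AE ->]]] [k [d [dI d0 AE' ->]]]; pose N := maxn m k.
have [cA <-] := graded_image_ext c0 (leq_maxl m k).
have [dA <-] := graded_image_ext d0 (leq_maxr m k).
apply: eq_big_nat => i iN; congr t; apply/eqP; rewrite -subr_eq0; apply/eqP.
case: gradI => _ _ uniq _.
apply: (uniq (maxn m k) (fun i => c i - d i)) => [l /andP[l0 _]||] //.
  by apply: submod_sub; [exact: I_submod | exact: cI | exact: dI].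
by rewrite sumrB cA dA -AE -AE' subrr.
Qed.

Let graded_image_lin a A D P Q : graded_image A P -> graded_image D Q ->
  graded_image (a *: A + D) (a%:P *: P + Q).
Proof.
move=> [m [c [cI c0 -> ->]]] [k [d [dI d0 -> ->]]].
have [<- <-] := graded_image_ext c0 (leq_maxl m k).
have [<- <-] := graded_image_ext d0 (leq_maxr m k).
exists (maxn m k), (fun i => a *: c i + d i); split.
- move=> i i0; have /submodP[_] := I_submod i0; apply; [exact: cI | exact: dI].
- by move=> i; rewrite geq_max => /andP[mi ki]; rewrite c0 // d0 // scaler0 addr0.
- by rewrite big_split scaler_sumr.
- rewrite scaler_sumr -big_split; apply: eq_big_nat => i /andP[i0 _] /=.
  rewrite /t R_lin; [|exact: (I_aug i0 (cI _ i0))|exact: (I_aug i0 (dI _ i0))].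
  by rewrite map_mxD map_mxZ scalerDr !scalerA mulrC.
Qed.

Let graded_image0 : graded_image 0 0.
Proof.
exists 0%N, (fun=> 0); split=> //; try by rewrite big_geq.
by move=> i i0; have /submodP[] := I_submod i0.
Qed.

Let graded_imageD A D P Q : graded_image A P -> graded_image D Q -> graded_image (A + D) (P + Q).
Proof. by move=> AP DQ; have := graded_image_lin 1 AP DQ; rewrite !scale1r. Qed.

Let graded_image_sum (J : eqType) (s : seq J) (f : J -> B -> B) (g : J -> MX) :
  (forall i, i \in s -> graded_image (f i) (g i)) ->
  graded_image (\sum_(i <- s) f i) (\sum_(i <- s) g i).
Proof.
elim: s => [|i s IH] fg; first by rewrite !big_nil; exact: graded_image0.
rewrite !big_cons; apply: graded_imageD; first by apply: fg; rewrite mem_head.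
by apply: IH => l ls; apply: fg; rewrite inE ls orbT.
Qed.

Let graded_image_hom i A : (0 < i)%N -> I i A -> graded_image A (t i A).
Proof.
move=> i0 IA; exists i.+1, (fun l => if l == i then A else 0); split.
- by move=> l l0; case: eqP => [->//|_]; have /submodP[] := I_submod l0.
- by move=> l il; case: eqP => // li; move: il; rewrite li ltnn.
- rewrite big_nat_recr //= eqxx big_nat_cond big1 ?add0r // => l /andP[/andP[_ li] _].
  by rewrite ltn_eqF.
- rewrite big_nat_recr //= eqxx big_nat_cond big1 ?add0r // => l /andP[/andP[_ li] _].
  by rewrite ltn_eqF.
Qed.

Let graded_image_aug A : env_aug G A -> exists P, graded_image A P.
Proof.
case: gradI => _ dec _ _ /dec[m [c [cI ->]]].
exists (\sum_(1 <= i < m) t i (c i)); apply: graded_image_sum => i.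
rewrite mem_index_iota => /andP[i0 im]; apply: graded_image_hom => //.
by apply: cI; rewrite i0.
Qed.

Let aug_graded_image A P : graded_image A P -> env_aug G A.
Proof.
move=> [m [c [cI _ -> _]]]; rewrite big_nat_cond; apply: submod_sum; first exact: env_aug_submod.
by move=> i /andP[/andP[i0 _] _]; exact: (I_aug i0 (cI _ i0)).
Qed.

Let graded_imageM A D P Q : graded_image A P -> graded_image D Q -> graded_image (D \o A) (P * Q).
Proof.
move=> [m [c [cI _ -> ->]]] [k [d [dI _ -> ->]]].
have -> : (\sum_(1 <= i < k) d i) \o (\sum_(1 <= i < m) c i) =
    \sum_(i <- index_iota 1 m) \sum_(l <- index_iota 1 k) (d l \o c i).
  apply: funext => v.
  transitivity (\sum_(l <- index_iota 1 k) \sum_(i <- index_iota 1 m) d l (c i v)).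
    rewrite /= fct_sumE; apply: eq_big_seq => l; rewrite mem_index_iota => /andP[l0 _].
    rewrite fct_sumE; have [y _ ->] := aug_in (I_aug l0 (dI l l0)).
    exact: (linear_sum (linear_map (env_map_linear y))).
  by rewrite exchange_big fct_sumE; apply: eq_bigr => i _; rewrite fct_sumE.
rewrite mulr_suml; apply: graded_image_sum => i; rewrite mem_index_iota => /andP[i0 _].
rewrite mulr_sumr; apply: graded_image_sum => l; rewrite mem_index_iota => /andP[l0 _].
case: gradI => _ _ _ /(_ i l _ _ i0 l0 (cI i i0) (dI l l0)) Idc.
have il0 : (0 < i + l)%N by rewrite addn_gt0 i0.
suff -> : t i (c i) * t l (d l) = t (i + l) (d l \o c i) by exact: graded_image_hom.
have [x Gx xE] := aug_in (I_aug i0 (cI i i0)); have [y Gy yE] := aug_in (I_aug l0 (dI l l0)).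
have [z Gz zE] := aug_in (I_aug il0 Idc).
rewrite /t zE xE yE !RE // (Mx_comp Gx Gy Gz) -?zE ?xE ?yE //.
by rewrite map_mxM -scalerAl -scalerAr scalerA exprD.
Qed.


(** Setting the variable to 1 adds up the components again, and all degrees are at least 1. *)
Let R_graded_image A P : graded_image A P ->
  map_mx (horner_eval 1) P = R A /\ exists P', P = 'X *: P'.
Proof.
move=> [m [c [cI _ -> ->]]]; split; last first.
  exists (\sum_(1 <= i < m) 'X^(i.-1) *: map_mx polyC (R (c i))); rewrite scaler_sumr.
  apply: eq_big_nat => i /andP[i0 _]; rewrite /t scalerA -exprS prednK //.
have {}cI i : i \in index_iota 1 m -> env_aug G (c i).
  by rewrite mem_index_iota => /andP[i0 _]; exact: (I_aug i0 (cI i i0)).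
elim: (index_iota 1 m) cI => [|i s IH] cI; first by rewrite !big_nil R0 map_mx0.
have ci := cI i (mem_head _ _).
have cs l : l \in s -> env_aug G (c l) by move=> ls; apply: cI; rewrite inE ls orbT.
have sG : env_aug G (\sum_(l <- s) c l).
  by rewrite big_seq; apply: submod_sum => //; exact: env_aug_submod.
rewrite !big_cons -[c i in RHS]scale1r R_lin // scale1r map_mxD IH //; congr (_ + _).
by apply/matrixP => k l; rewrite /t !mxE /= /horner_eval hornerM hornerXn expr1n mul1r hornerC.
Qed.

Let op1_aug g : G g -> env_aug G (tree_op_sub1 g).
Proof.
have G1 := subgroup1 subG; move=> Gg; exists (<< g >> - << 1%g >>); first split.
- by apply: (submod_sub (group_algebra_submod G));  exact: group_algebraU.
- rewrite /= -scaleN1r addrC; have := @augmentation_linear p (-1) << 1%g >> << g >>.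
  by rewrite !augmentationU => ->; rewrite scaleN1r addNr.
- rewrite /= -scaleN1r addrC env_map_is_linear !env_mapU /tree_op_sub1 scaleN1r addrC.
  by [].
Qed.

Let tree_op1 v : tree_op (1%g : tree_aut p) v = v.
Proof.
apply: (@freeg_linear_eq _ _ _ (fglift (fun xi : boundary p => << boundary_act 1%g xi >>)) idfun) => xi.
by rewrite /= liftU scale1r; congr << _ >>; exact: val_inj.
Qed.

Let Q g : MX := xget 0 [set P | graded_image (tree_op_sub1 g) P].

Let QP g : G g -> graded_image (tree_op_sub1 g) (Q g).
Proof.
move=> Gg; have [P gP] := graded_image_aug (op1_aug Gg).
by apply: (@xgetPex _ 0 [set P | graded_image (tree_op_sub1 g) P]); exists P.
Qed.

(** This is gh - 1 = (g - 1) + (h - 1) + (g - 1)(h - 1); it makes 1 + Q multiplicative on G. *)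
Let QM g h : G g -> G h -> Q (g * h)%g = Q g + Q h + Q g * Q h.
Proof.
move=> Gg Gh; apply: (graded_image_uniq (QP (subgroupM subG Gg Gh))).
have -> : tree_op_sub1 (g * h)%g =
    tree_op_sub1 g + tree_op_sub1 h + (tree_op_sub1 h \o tree_op_sub1 g).
  apply: funext => v; rewrite /tree_op_sub1 tree_opM.
  rewrite -[LHS]/(tree_op h (tree_op g v) - tree_op 1%g v).
  rewrite -[RHS]/(tree_op g v - tree_op 1%g v + (tree_op h v - tree_op 1%g v) +
    (tree_op h (tree_op g v - tree_op 1%g v) - tree_op 1%g (tree_op g v - tree_op 1%g v))).
  rewrite !tree_op1; have -> : tree_op h (tree_op g v - v) = tree_op h (tree_op g v) - tree_op h v.
    exact: (linearB (fglift (fun xi : boundary p => << boundary_act h xi >>))).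
  set x := tree_op g v; set y := tree_op h v; set z := tree_op h x.
  set A := x - v; rewrite [z - y - A]addrC addrACA subrr add0r.
  by rewrite [RHS]addrC addrA subrK.
by apply: graded_imageD; [apply: graded_imageD; exact: QP | apply: graded_imageM; exact: QP].
Qed.

Let Q1 : Q 1%g = 0.
Proof.
apply: (graded_image_uniq (QP (subgroup1 subG))).
by rewrite /tree_op_sub1 subrr; exact: graded_image0.
Qed.

Variable x0 : FA.
Hypotheses (Gx0 : FG x0) (x0_aug : augmentation x0 = 0).
Hypothesis x0_nil : forall m, Mx x0 ^+ m != 0.

(* A finite image would bound the degrees of all P, but the powers of a non-nilpotent *)
(* element of the augmentation ideal have images of arbitrarily large order.          *)
Let infinite_image : ~ finite_set (Q @` G).
Proof.
move=> /finite_seqP[s sE]; pose D := (\max_(P <- s) \max_i \max_j size ((P : MX) i j))%N.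
have small g i j : G g -> (size (Q g i j) <= D)%N.
  move=> Gg; have : [set` s] (Q g) by rewrite -sE; exists g.
  move=> /= gs; rewrite /D (big_rem _ gs) /=.
  rewrite (leq_trans _ (leq_maxl _ _)) // (leq_trans _ (leq_bigmax i)) //.
  exact: (leq_bigmax j).
(* Every element minus its augmentation is a combination of the elements g - 1, so the degree bound
   for these passes to the whole augmentation ideal. *)
pose W : set FA := [set x | exists2 P, graded_image (env_map x - augmentation x *: tree_op 1%g) P &
  forall i j, (size ((P : MX) i j) <= D)%N].
have WG : FG `<=` W.
  move=> x; apply: group_algebra_ind => [|g Gg]; last first.
    exists (Q g) => [|i j]; last exact: small.
    by rewrite env_mapU augmentationU scale1r; exact: QP.
  apply/submodP; split.
    exists 0 => [|i j]; last by rewrite mxE size_poly0.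
    have -> : augmentation (0 : FA) = 0 by exact: (linear0 (linear_map (@augmentation_linear p))).
    by rewrite env_map0 scale0r subr0; exact: graded_image0.
  move=> c {}x y [P xP Ps] [P' yP P's]; exists (c%:P *: P + P') => [|i j].
    have := graded_image_lin c xP yP.
    rewrite env_map_is_linear augmentation_linear scalerBr scalerA addrACA -opprD -scalerDl.
    by [].
  rewrite !mxE mul_polyC (leq_trans (size_polyD _ _)) // geq_max P's andbT.
  exact: leq_trans (size_scale_leq _ _) (Ps i j).
have bounded A P i j : graded_image A P -> (size (P i j) <= D)%N.
  move=> AP; have [x [Gx xa] xA] := aug_graded_image AP.
  have [P' xP' P's] := WG x Gx.
  suff -> : P = P' by [].
  by apply: (graded_image_uniq AP); move: xP'; rewrite xa scale0r subr0 xA.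
have a0 : env_aug G (env_map x0) by exists x0.
have [P aP] := graded_image_aug a0; have [PR [P' PE]] := R_graded_image aP.
have powers m : exists A, graded_image A (P ^+ m.+1).
  elim: m => [|m [A AP]]; first by exists (env_map x0); rewrite expr1.
  by exists (env_map x0 \o A); rewrite exprSr; exact: graded_imageM.
have [A AP] := powers D; have := x0_nil D.+1.
have -> : Mx x0 ^+ D.+1 = map_mx (horner_eval 1) (P ^+ D.+1) by rewrite rmorphXn /= PR RE.
apply/negP/negPn/eqP/matrixP => i j; rewrite [LHS]mxE [RHS]mxE.
(* The entry has size at most D but is divisible by the power D + 1 of the variable. *)
suff -> : (P ^+ D.+1) i j = 0 by rewrite /horner_eval horner0.
have := bounded _ _ i j AP; rewrite PE exprZn mxE => le.
have [->|N0] := eqVneq ((P' ^+ D.+1) i j) 0; first by rewrite mulr0.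
move: le; rewrite mulrC size_Mmonic ?monicXn // size_polyXn addnS /=.
have : (0 < size ((P' ^+ D.+1) i j)%R)%N by rewrite size_poly_gt0.
lia.
Qed.

Hypothesis jiG : just_infinite G.
Hypothesis pairsG : forall N, exists x y : nat -> tree_aut p,
  [/\ forall i, (i < N)%N -> G (x i) /\ G (y i),
      forall i, (i < N)%N -> (x i * y i <> y i * x i)%g
    & forall i k, (i < N)%N -> (k < N)%N -> i != k -> (x i * y k = y k * x i)%g].

(** The homomorphism 1 + Q has infinite image, so its kernel has infinite index and is trivial.
    Being injective, it carries the commuting pairs of G to pairs of matrices with the same
    commutation pattern, one more than [commuting_pairs_bound] allows. *)
Lemma graded_contradiction : False.
Proof.
pose P g := 1 + Q g.
have PM g h : G g -> G h -> P (g * h)%g = P g * P h.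
  move=> Gg Gh; rewrite /P QM // mulrDl mul1r [Q g * (1 + _)]mulrDr mulr1 !addrA.
  by rewrite [1 + Q h + Q g]addrAC.
have G1 := subgroup1 subG; have P1 : P 1%g = 1 by rewrite /P Q1 addr0.
pose K := [set g | G g /\ P g = 1].
have PV g : G g -> P g * P (g^-1)%g = 1 by move=> Gg; rewrite -PM ?mulgV //; exact: subgroupV.
have PVl g : G g -> P (g^-1)%g * P g = 1 by move=> Gg; rewrite -PM ?mulVg //; exact: subgroupV.
have normK : normal_in K G.
  split; [|by move=> g []|].
    apply/subgroupP; split=> // g h [Gg gK] [Gh hK]; have hV := subgroupV subG Gh.
    split; first exact: (subgroupM subG).
    by rewrite PM // gK -hK PV.
  move=> g h [Gg gK] Gh; have hV := subgroupV subG Gh; split; first exact: subgroupJ.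
  by rewrite conjgE !PM //; [rewrite gK mul1r PVl | exact: (subgroupM subG)].
have K1 : K = [set 1%g].
  apply: contra_notP infinite_image => /(jiG.2 _ normK) fin.
  apply: (finite_image_quotient fin) => // g x Gg [Gx Px].
  by apply: (addrI 1); rewrite -!/(P _) PM // Px mulr1.
have Pinj g h : G g -> G h -> P g = P h -> g = h.
  move=> Gg Gh gh; have hV := subgroupV subG Gh; have : K (g * h^-1)%g.
    by split; [exact: (subgroupM subG) | rewrite PM // gh PV].
  by rewrite K1 => /= /(congr1 (fun k => k * h)%g); rewrite mulgVK mul1g.
have [x [y [xyG xyN xyC]]] := pairsG (n.+1 * n.+1).+1.
(* The fraction field of the polynomial ring is used because the bound is linear algebra over a
   field. *)
pose T g := map_mx (@FracField.tofrac {poly 'F_p}) (P g).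
have := @commuting_pairs_bound {fraction {poly 'F_p}} n.+1 (n.+1 * n.+1).+1 (T \o x) (T \o y).
have TE g h : G g -> G h -> T g *m T h = T (g * h)%g by move=> Gg Gh; rewrite -map_mxM -[X in map_mx _ X]PM.
rewrite ltnn => bound; suff : false by []; apply: bound => [i k iN kN ik|i iN] /=.
  have [[Gx _] [_ Gy]] := (xyG _ iN, xyG _ kN).
  by rewrite !TE // xyC.
have [Gx Gy] := xyG _ iN; rewrite !TE // => E; apply: (xyN _ iN).
apply: Pinj; [exact: (subgroupM subG) | exact: (subgroupM subG) |].
apply/matrixP => u v; have := congr1 (fun M : 'M_n.+1 => M u v) E.
by rewrite /T [LHS]mxE [RHS]mxE => /eqP; rewrite tofrac_eq => /eqP.
Qed.

End Graded.

(** * Finite-dimensional quotients are excluded *)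

Section PartialLinearMaps.
Variables (F : fieldType) (U V : lmodType F) (C : set U) (pi : U -> V).
Hypotheses (subC : submod_closed [in C]).
Hypothesis piL : forall c x y, C x -> C y -> pi (c *: x + y) = c *: pi x + pi y.

Lemma partial_linear0 : pi 0 = 0.
Proof.
have C0 : C 0 by have /submodP[] := subC.
by have := piL (-1) C0 C0; rewrite scaler0 addr0 scaleN1r addNr.
Qed.

Lemma partial_linear_scale c x : C x -> pi (c *: x) = c *: pi x.
Proof.
have C0 : C 0 by have /submodP[] := subC.
by move=> Cx; have := piL c Cx C0; rewrite addr0 partial_linear0 addr0.
Qed.

Lemma partial_linear_sum (J : Type) (s : seq J) (f : J -> U) : (forall i, C (f i)) ->
  pi (\sum_(i <- s) f i) = \sum_(i <- s) pi (f i).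
Proof.
move=> Cf; elim: s => [|i s IH]; first by rewrite !big_nil partial_linear0.
rewrite !big_cons -[f i]scale1r piL ?IH ?scale1r //; exact: submod_sum.
Qed.

Lemma partial_linear_eq x y : C x -> C y -> pi (x - y) = 0 -> pi x = pi y.
Proof.
move=> Cx Cy; rewrite addrC -scaleN1r piL // scaleN1r addrC => /eqP.
by rewrite subr_eq0 => /eqP.
Qed.

End PartialLinearMaps.

(** The action of KJ, with K and J the sums of the first p powers of b and of a. *)
Definition norm_product (p : nat) (V : lmodType 'F_p) (gT : groupType) (r : gT -> {linear V -> V})
  (a b : gT) (v : V) : V := \sum_(l < p) \sum_(k < p) r (b ^+ l * a ^+ k)%g v.

Lemma norm_product_pi (p : nat) (U V : lmodType 'F_p) (gT : groupType) (G : set gT)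
    (r : gT -> {linear U -> U}) (rho : gT -> {linear V -> V}) (C : set U) (pi : U -> V) a b u :
  is_subgroup G -> G a -> G b -> submod_closed [in C] -> C u ->
  (forall g x, G g -> C x -> C (r g x)) ->
  (forall c x y, C x -> C y -> pi (c *: x + y) = c *: pi x + pi y) ->
  (forall g x, G g -> C x -> pi (r g x) = rho g (pi x)) ->
  C (norm_product r a b u) /\ pi (norm_product r a b u) = norm_product rho a b (pi u).
Proof.
move=> subG Ga Gb subC Cu GC piL rE.
have Gba l k : G (b ^+ l * a ^+ k)%g by apply: subgroupM => //; exact: subgroupX.
have Cs l : C (\sum_(k < p) r (b ^+ l * a ^+ k)%g u) by apply: submod_sum => // k _; exact: GC.
split; first by apply: submod_sum.
rewrite /norm_product (partial_linear_sum subC piL) //; apply: eq_bigr => l _.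
by rewrite (partial_linear_sum subC piL) => [|k]; [apply: eq_bigr => k _; exact: rE | exact: GC].
Qed.

Lemma finite_dimensional_image (F : fieldType) (V : lmodType F) (T : finType) (f : T -> V) :
  (forall v, exists t, f t = v) -> finite_dimensional F V.
Proof.
move=> surj; exists #|T|, (fun i => f (enum_val i)) => v; have [t <-] := surj v.
exists (fun i => (i == enum_rank t)%:R); rewrite (bigD1 (enum_rank t)) //= eqxx enum_rankK scale1r.
by rewrite big1 ?addr0 // => i /negPf ->; rewrite scale0r.
Qed.

(** In a finite-dimensional V, pass to an irreducible subquotient for H in which v survives. There H
    acts trivially, so KJ is multiplication by p^2 = 0 and cannot fix the image of v up to [lam]. *)
Lemma ptorsion_norm_product (p : nat) (V : lmodType 'F_p) (gT : groupType) (H : set gT)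
    (rho : gT -> {linear V -> V}) (a b : gT) (lam : 'F_p) (v : V) : prime p ->
  is_subgroup H -> is_repr H rho -> H a -> H b ->
  (forall h, H h -> exists m, (h ^+ (p ^ m))%g = 1%g) ->
  v != 0 -> lam *: norm_product rho a b v = v -> ~ finite_dimensional 'F_p V.
Proof.
move=> p_pr HS rH Ha Hb HT v0 vE fd.
have D0 : submod_closed [in [set (0 : V)]].
  by apply/submodP; split=> // c x y /= -> ->; rewrite scaler0 addr0.
have DH g x : H g -> [set (0 : V)] x -> [set (0 : V)] (rho g x) by move=> _ /= ->; rewrite linear0.
have nDv : ~ [set (0 : V)] v by move=> /= ve; rewrite ve eqxx in v0.
have [W [sigma [C [pi [[rW irrW subC Cv HC] [piL pi_surj _ piv piE]]]]]] :=
  simple_subquotient HS rH D0 DH nDv.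
(* V is finite as a set, so its subquotient is finite too and is spanned by the list of its
   elements. *)
have fdW : finite_dimensional 'F_p W.
  have [n [crd [_ [icrd crdK icrdK]]]] := finite_dimensional_coord fd.
  apply: (finite_dimensional_image (f := fun x => pi (icrd x))) => w.
  by have [x _ <-] := pi_surj w; exists (crd x); rewrite crdK.
have triv := irreducible_ptorsion_trivial p_pr HS rW irrW fdW HT.
have [Cn piN] := norm_product_pi HS Ha Hb subC Cv HC piL piE.
case/eqP: piv; rewrite -vE (partial_linear_scale subC piL) // piN.
have pmul (w : W) : w *+ p = 0 by rewrite -scaler_nat Fp_pnat0 // scale0r.
rewrite /norm_product big1 ?scaler0 // => l _.
rewrite (eq_bigr (fun=> pi v)) => [|k _]; first by rewrite sumr_const card_ord pmul.
by apply: triv; apply: subgroupM => //; exact: subgroupX.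
Qed.

Lemma conj_setP (gT : groupType) (G : set gT) h g : G g -> conj_set G h (g ^ h)%g.
Proof. by exists g. Qed.

Lemma conj_subgroup (gT : groupType) (G : set gT) h : is_subgroup G -> is_subgroup (conj_set G h).
Proof.
move=> subG; apply/subgroupP; split; first by exists 1%g; [exact: subgroup1 | exact: conj1g].
move=> _ _ [g Gg <-] [k Gk <-]; exists (g / k)%g; last by rewrite conjMg conjVg.
by apply: subgroupM => //; exact: subgroupV.
Qed.

(** Translating f by the inverse of h intertwines the two actions and preserves nullity along
    rays. *)
Lemma conj_eigenvector (p : nat) (a b h : tree_aut p) (lam : 'F_p) (f : word_function p) :
  ~ ray_null f -> ray_null (lam *: norm_product (@word_act p) a b f - f) ->
  exists f', ~ ray_null f' /\
    ray_null (lam *: norm_product (@word_act p) (a ^ h)%g (b ^ h)%g f' - f').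
Proof.
move=> f0 fE; exists (word_act (h^-1)%g f).
have actM g k (u : word_function p) : word_act (g * k)%g u = word_act g (word_act k u) by apply: funext.
split=> [hf|].
  apply: f0; have := word_act_ray_null h hf; rewrite -actM mulgV.
  by rewrite (_ : word_act 1%g f = f) //; exact: funext.
suff -> : norm_product (@word_act p) (a ^ h)%g (b ^ h)%g (word_act (h^-1)%g f) =
    word_act (h^-1)%g (norm_product (@word_act p) a b f).
  by rewrite -linearZ -linearB; exact: word_act_ray_null.
rewrite /norm_product linear_sum; apply: eq_bigr => l _.
rewrite linear_sum; apply: eq_bigr => k _; rewrite -!actM; congr (word_act _ f).
by rewrite -!conjXg -conjMg conjgE -mulgA mulgK !mulgA.
Qed.

Section WordQuotient.
Variables (p : nat) (G : set (tree_aut p)) (a b : tree_aut p) (lam : 'F_p) (f : word_function p).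
Hypotheses (p_prime : prime p) (subG : is_subgroup G) (Ga : G a) (Gb : G b).
Hypothesis fE : ray_null (lam *: norm_product (@word_act p) a b f - f).
Variables (V : lmodType 'F_p) (rho : tree_aut p -> {linear V -> V}).
Variables (C : set (word_function p)) (pi : word_function p -> V).
Hypotheses (subC : submod_closed [in C]) (Cf : C f) (rG : is_repr G rho).
Hypothesis GC : forall g x, G g -> C x -> C (word_act g x).
Hypothesis piL : forall c x y, C x -> C y -> pi (c *: x + y) = c *: pi x + pi y.
Hypothesis pi_surj : forall v, exists2 x, C x & pi x = v.
Hypothesis pi_null : forall x, C x -> ray_null x -> pi x = 0.
Hypothesis piE : forall g x, G g -> C x -> pi (word_act g x) = rho g (pi x).
Hypothesis pif : pi f != 0.

Lemma quotient_eigenvector : lam *: norm_product rho a b (pi f) = pi f.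
Proof.
have [Cn piN] := norm_product_pi subG Ga Gb subC Cf GC piL piE.
rewrite -piN -(partial_linear_scale subC piL) //.
have Cs : C (lam *: norm_product (@word_act p) a b f) by exact: submod_scale.
by apply: (partial_linear_eq piL) => //; apply: pi_null => //; exact: submod_sub.
Qed.

(** If V had finite dimension, the matrices of G on V would extend linearly to a map [Mx] that
    factors through the enveloping algebra, as the action on vertex functions does. The element
    [lam] KJ has augmentation 0 and fixes the nonzero vector [pi f], so it is not nilpotent and
    [graded_contradiction] applies. *)
Lemma graded_infinite_dimensional (I : nat -> set (boundary_space p -> boundary_space p)) :
  is_grading (env_aug G) I -> just_infinite G ->
  (forall N, exists x y : nat -> tree_aut p,
    [/\ forall i, (i < N)%N -> G (x i) /\ G (y i),
        forall i, (i < N)%N -> (x i * y i <> y i * x i)%g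
      & forall i k, (i < N)%N -> (k < N)%N -> i != k -> (x i * y k = y k * x i)%g]) ->
  ~ finite_dimensional 'F_p V.
Proof.
move=> gradI jiG pairsG /finite_dimensional_coord[n [crd [crdL [icrd crdK icrdK]]]].
have p0 := prime_gt0 p_prime.
have icrdL : linear icrd.
  by move=> c u v; apply: (can_inj crdK); rewrite icrdK crdL !icrdK.
have mxP g : {A : 'M['F_p]_n | forall v, crd (rho g v) = A *m crd v}.
  apply: cid; have fL : linear (fun x => crd (rho g (icrd x))).
    by move=> c u v; rewrite icrdL linearP crdL.
  by have [A AE] := matrix_of_linear fL; exists A => v; rewrite -AE crdK.
case: n crd crdL icrd crdK icrdK icrdL mxP => [|n] crd crdL icrd crdK icrdK icrdL mxP.
  case/eqP: pif; apply: (can_inj crdK); rewrite [LHS]flatmx0 [RHS]flatmx0 //.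
have crd0 : crd 0 = 0 by exact: (linear0 (linear_map crdL)).
pose mx g := sval (mxP g).
have mxE' g v : crd (rho g v) = mx g *m crd v by exact: (svalP (mxP g)).
pose Mx := fglift mx : {freeg (tree_aut p) / 'F_p} -> 'M['F_p]_n.+1.
have MxL : linear Mx by exact: linearP.
have combC x u : group_algebra G x -> C u ->
    C (word_combination x u) /\ crd (pi (word_combination x u)) = Mx x *m crd (pi u).
  move=> Gx Cu; pose W : set {freeg (tree_aut p) / 'F_p} := [set x | C (word_combination x u) /\
    crd (pi (word_combination x u)) = Mx x *m crd (pi u)].
  apply: (@group_algebra_ind _ G W) => // [|g Gg]; last first.
    rewrite /W /= word_combinationU; split; first exact: GC.
    by rewrite piE // mxE' /Mx liftU scale1r.
  have comb0 : word_combination 0 u = 0 by exact: (linear0 (linear_map (word_combination_linear u))).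
  have Mx0 : Mx 0 = 0 by exact: (linear0 (linear_map MxL)).
  apply/submodP; split.
    rewrite /W /= comb0 (partial_linear0 subC piL) Mx0 mul0mx crd0.
    by split=> //; have /submodP[] := subC.
  move=> c y z [Cy yE] [Cz zE]; rewrite /W /= word_combination_linear; split.
    by have /submodP[_] := subC; apply.
  by rewrite piL // crdL yE zE MxL mulmxDl scalemxAl.
have Mx_eq (A D : 'M['F_p]_n.+1) : (forall u, C u -> A *m crd (pi u) = D *m crd (pi u)) -> A = D.
  move=> AD; apply/trmx_inj/row_matrixP => i; apply: trmx_inj.
  rewrite -!tr_col !trmxK !colE; have [u Cu uE] := pi_surj (icrd (delta_mx i ord0)).
  by have := AD u Cu; rewrite uE icrdK.
pose x0 : {freeg (tree_aut p) / 'F_p} := lam *: \sum_(l < p) \sum_(k < p) << (b ^+ l * a ^+ k)%g >>.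
have Gba l k : G (b ^+ l * a ^+ k)%g by apply: (subgroupM subG); exact: (subgroupX _ subG).
have Gx0 : group_algebra G x0.
  have GS := group_algebra_submod G; apply: (submod_scale _ GS).
  by apply: (submod_sum _ GS) => l _; apply: (submod_sum _ GS) => k _; exact: group_algebraU.
have x0_aug : augmentation x0 = 0.
  pose aug := linear_map (@augmentation_linear p).
  have S0 : aug (\sum_(l < p) \sum_(k < p) << (b ^+ l * a ^+ k)%g >>) = 0.
    rewrite linear_sum big1 // => l _.
    rewrite linear_sum (eq_bigr (fun=> 1)) => [|k _]; last exact: augmentationU.
    by rewrite sumr_const card_ord; exact: Fp_pnat0.
  by rewrite -[LHS]/(aug x0) linearZ S0; exact: mulr0.
have x0f : word_combination x0 f = lam *: norm_product (@word_act p) a b f.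
  pose wc := linear_map (word_combination_linear f); rewrite -[LHS]/(wc x0) linearZ; congr (_ *: _).
  rewrite linear_sum; apply: eq_bigr => l _; rewrite linear_sum; apply: eq_bigr => k _.
  exact: word_combinationU.
have [Cx0f x0E] := combC _ _ Gx0 Cf.
have x0v : Mx x0 *m crd (pi f) = crd (pi f).
  rewrite -x0E; congr crd; apply: (partial_linear_eq piL) => //.
  by apply: pi_null; [exact: submod_sub | rewrite x0f].
have x0_nil m : Mx x0 ^+ m != 0.
  apply/eqP => x0m; have : Mx x0 ^+ m *m crd (pi f) = crd (pi f).
    elim: m {x0m} => [|m IH]; first by rewrite expr0 mul1mx.
    by rewrite exprS -mulmxA IH.
  rewrite x0m mul0mx => f0; case/eqP: pif; apply: (can_inj crdK).
  by rewrite -f0 crd0.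
apply: (@graded_contradiction p n G Mx I subG MxL _ _ gradI x0 Gx0 x0_aug x0_nil jiG pairsG) => [x y Gx Gy xy|x y z Gx Gy Gz zE].
  apply: Mx_eq => u Cu; rewrite -(combC x u Gx Cu).2 -(combC y u Gy Cu).2.
  by rewrite (word_combination_env u p0 xy).
apply: Mx_eq => u Cu; have [Cy yE] := combC y u Gy Cu.
by rewrite -mulmxA -yE -(combC x _ Gx Cy).2 -(combC z u Gz Cu).2 (word_combinationM u p0 zE).
Qed.

End WordQuotient.

(** * The defining vectors of the generators, and the conclusion *)

Lemma sum_Fp (p : nat) : prime p -> odd p -> \sum_(x : 'F_p) x = 0.
Proof.
move=> p_pr p_odd; set S := \sum_x x.
have SN : S = - S by rewrite /S {1}(reindex_inj oppr_inj) sumrN.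
have /eqP : S *+ 2 = 0 by rewrite mulr2n {1}SN addNr.
rewrite -mulr_natr mulf_eq0 => /orP[/eqP//|]; rewrite -(dvdn_pcharf (pchar_Fp p_pr)).
by rewrite dvdn_prime2 // => /eqP p2; rewrite p2 in p_odd.
Qed.

(** The p - 1 entries run through the p - 1 nonzero residues, so each occurs once, and the sum of
    all residues is its own negative. *)
Lemma gupta_sidki_sum (p : nat) (e : 'rV['F_p]_p.-1) : prime p -> odd p ->
  [set e ord0 t | t in [set: 'I_p.-1]] = [set x | x != 0] -> \sum_t e ord0 t = 0.
Proof.
move=> p_pr p_odd eE; rewrite -[RHS](sum_Fp p_pr p_odd) [RHS](bigD1 0) //= add0r.
pose f t := e ord0 t.
have f_img x : (x \in codom f) = (x != 0).
  apply/codomP/idP => [[t ->]|x0]; first by have : [set y | y != 0] (f t) by rewrite -eE; exists t.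
  have : [set y : 'F_p | y != 0] x := x0.
  by rewrite -eE => -[t _ tx]; exists t.
have f_inj : injective f.
  apply: in2T; apply/image_injP; rewrite (eq_card f_img) card_ord.
  by rewrite (cardC1 (0 : 'F_p)) card_Fp.
transitivity (\sum_(x <- codom f) x); first by rewrite [RHS]big_image; exact: eq_bigl.
rewrite -big_filter; apply: perm_big; apply: uniq_perm => [||x].
- by rewrite map_inj_uniq // enum_uniq.
- by rewrite filter_uniq // index_enum_uniq.
- by rewrite mem_filter mem_index_enum andbT f_img.
Qed.

Lemma spinal_datum_generator (p : nat) (E : spinal_datum p) :
  exists (j : 'I_p) (i : 'I_(sd_rank E j)), row i (sd_vec E j) != 0.
Proof.
have [j j0] := sd_rank_neq0 E.
have r0 : (0 < sd_rank E j)%N by rewrite lt0n.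
exists j, (Ordinal r0); apply/eqP => r_0.
have : delta_mx (ord0 : 'I_1) (Ordinal r0) *m sd_vec E j = 0 *m sd_vec E j by rewrite -rowE r_0 mul0mx.
move=> /(row_free_inj (sd_free E j)) /matrixP /(_ ord0 (Ordinal r0)).
by rewrite !mxE !eqxx => /eqP; rewrite oner_eq0.
Qed.

(** The common end of both cases: what is needed is a nonzero eigenvector and a reason why its
    irreducible subquotient cannot be finite-dimensional, either a p-torsion subgroup that contains
    a and b, or a grading together with the commuting pairs. *)
Lemma irreducible_of_eigenvector (p : nat) (G : set (tree_aut p)) (a b : tree_aut p)
    (lam : 'F_p) (f : word_function p) :
  prime p -> is_subgroup G -> G a -> G b -> just_infinite G -> ~ ray_null f ->
  ray_null (lam *: norm_product (@word_act p) a b f - f) ->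
  ((exists2 H : set (tree_aut p), [/\ is_subgroup H, H a & H b] &
      H `<=` G /\ forall h, H h -> exists m, (h ^+ (p ^ m))%g = 1%g) \/
   ((exists I, is_grading (env_aug G) I) /\
    forall N, exists x y : nat -> tree_aut p,
    [/\ forall i, (i < N)%N -> G (x i) /\ G (y i),
        forall i, (i < N)%N -> (x i * y i <> y i * x i)%g
      & forall i k, (i < N)%N -> (k < N)%N -> i != k -> (x i * y k = y k * x i)%g])) ->
  exists (V : lmodType 'F_p) (rho : tree_aut p -> {linear V -> V}),
    [/\ is_repr G rho, repr_faithful G rho, repr_irreducible G rho
      & ~ finite_dimensional 'F_p V].
Proof.
move=> p_pr subG Ga Gb jiG f0 fE hyp.
have [V [rho [C [pi [[rG irr subC Cf GC] [piL pi_surj pi_null pif piE]]]]]] :=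
  simple_subquotient subG (word_act_repr G) (@ray_null_submod p)
    (fun g v _ => @word_act_ray_null p g v) f0.
have infV : ~ finite_dimensional 'F_p V.
  case: hyp => [[H [subH Ha Hb] [HG HT]]|[[I gradI] pairsG]].
    have rH : is_repr H rho.
      by have [r1 rM] := rG; split=> // g h v Hg Hh; apply: rM; exact: HG.
    apply: (ptorsion_norm_product p_pr subH rH Ha Hb HT pif).
    exact: (quotient_eigenvector subG Ga Gb fE subC Cf GC piL pi_null piE).
  exact: (graded_infinite_dimensional p_pr subG Ga Gb fE subC Cf GC piL pi_surj pi_null piE pif gradI).
exists V, rho; split=> //; exact: infinite_irreducible_faithful.
Qed.

Theorem theorem1p5 (p : nat) (p_prime : prime p) (p_odd : odd p)
    (E : spinal_datum p) (h : tree_aut p) (G : set (tree_aut p))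
    (defG : G = conj_set (spinal_group E) h)
    (G_just_infinite : just_infinite G)
    (hyp :
      (exists2 H : set (tree_aut p), gen_gupta_sidki H & H `<=` G) \/
      (exists2 I : nat -> set (boundary_space p -> boundary_space p),
         is_grading (env_aug G) I &
         homogeneous I (tree_op_sub1 (rooted p ^ h)%g) /\
         forall (j : 'I_p) (i : 'I_(sd_rank E j)),
           homogeneous I (tree_op_sub1 (sd_gen i ^ h)%g))) :
  exists (V : lmodType 'F_p) (rho : tree_aut p -> {linear V -> V}),
    [/\ is_repr G rho, repr_faithful G rho, repr_irreducible G rho
      & ~ finite_dimensional 'F_p V].
Proof.
have subE : is_subgroup (spinal_group E) by exact: generated_subgroup.
have subG : is_subgroup G by rewrite defG; exact: conj_subgroup.
case: hyp => [[H [e [eE HE]] HG]|[I gradI _]].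
  have subH : is_subgroup H by rewrite HE; exact: generated_subgroup.
  have Ha : H (rooted p) by rewrite HE; apply: sub_generated; left.
  have Hb : H (spinal 0 e) by rewrite HE; apply: sub_generated; right.
  have e0 : e != 0.
    apply/eqP => e0; have : [set x : 'F_p | x != 0] 1 by exact: oner_neq0.
    by rewrite -eE => -[t _]; rewrite e0 mxE => /eqP; rewrite eq_sym oner_eq0.
  have [lam [f [f0 fE]]] := eigenvector 0 p_prime e0.
  apply: (irreducible_of_eigenvector p_prime subG (HG _ Ha) (HG _ Hb) G_just_infinite f0 fE).
  left; exists H => //; split=> // g; rewrite HE.
  exact: (spinal_rank2_torsion p_prime (gupta_sidki_sum p_prime p_odd eE)).
(* In the graded case any nonzero defining vector will do. The eigenvector and the commuting pairs
   are found in the standard form and then conjugated by h. *)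
have [j [i ei]] := spinal_datum_generator E.
have [lam [f0 [f0N f0E]]] := eigenvector j p_prime ei.
have [f [fN fE]] := conj_eigenvector h f0N f0E.
have Ea : spinal_group E (rooted p) by apply: sub_generated; left.
have Eb : spinal_group E (spinal j (row i (sd_vec E j))).
  by apply: sub_generated; right; exists j, i.
have Ga : G (rooted p ^ h)%g by rewrite defG; exact: conj_setP.
have Gb : G (spinal j (row i (sd_vec E j)) ^ h)%g by rewrite defG; exact: conj_setP.
apply: (irreducible_of_eigenvector p_prime subG Ga Gb G_just_infinite fN fE).
right; split; first by exists I.
move=> N; have [x [y [xyG xyN xyC]]] := commuting_pairs j p_prime p_odd ei N.
have rank2_sub g : derived (derived (spinal_rank2 j (row i (sd_vec E j)))) g -> G (g ^ h)%g.
  move=> /second_derived_sub gE; rewrite defG; apply: conj_setP.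
  by apply: (generated_min subE) gE => _ [->|->].
exists (fun n => (x n ^ h)%g), (fun n => (y n ^ h)%g); split=> [n nN|n nN|n m nN mN nm].
- by have [xG yG] := xyG n nN; split; exact: rank2_sub.
- by rewrite -!conjMg => /conjg_inj; exact: xyN.
- by rewrite -!conjMg xyC.
Qed.
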